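(* Let $\boldsymbol{a}=(a_1,\dots,a_N)$ be a sequence of positive integers with $\gcd(\boldsymbol{a})=1$, and let $f$ be a positive integer dividing some $a_i$. Let $W_f(t;\boldsymbol{a})$ be the Sylvester wave and let Cyc-Denum be the algorithm described in the context. (1) Algorithm Cyc-Denum correctly computes $W_1(t;\boldsymbol{a})$ using $O(N\log^2(N))$ operations in $\mathbb{Q}$. (2) For $f>1$, Algorithm Cyc-Denum correctly computes $W_f(t;\boldsymbol{a})$ using $O(d)$ operations in $\mathbb{Q}[x]/\langle x^f-1\rangle$ and $O\big(f\,d\log(d)+N\log^2(d)\big)$ operations in $R=\mathbb{Q}[x]/\langle\Phi_f(x)\rangle$, where $d=n(f\mid\boldsymbol{a})=\#\{i: f\mid a_i\}$.
   Context: Notation. $\mathcal{P}_f$ is the set of primitive $f$-th roots of unity in $\mathbb{C}$, $\Phi_f(x)=\prod_{\zeta\in\mathcal{P}_f}(x-\zeta)$, $\widehat{\Phi}_f(x)=\frac{x^f-1}{\Phi_f(x)}$, $\theta_f(x)=\sum_{i=0}^{f-1}x^i$. The Sylvester wave is $$W_f(t;\boldsymbol{a})=-\operatorname{Res}_{s=0}\sum_{\zeta\in\mathcal{P}_f}\frac{\zeta^{-t}e^{-ts}}{\prod_{i=1}^N(1-\zeta^{a_i}e^{a_is})}.$$ As a function of the (symbolic) nonnegative integer $t$ it is a quasi-polynomial of period $f$, and computing it means computing polynomials $P_1,\dots,P_f$ such that $W_f(t;\boldsymbol{a})=P_i(t)$ whenever $t\equiv i\pmod f$, $1\le i\le f$;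 this is written $W_f(t;\boldsymbol{a})=[P_1(t),\dots,P_f(t)]$. Elements of $R=\mathbb{Q}[x]/\langle\Phi_f(x)\rangle$ are represented by the standard form $\langle P(x)\rangle_R$, the unique representative of degree at most $\varphi(f)-1$ ($\varphi$ is Euler's totient). Let $g(s)=\frac{s}{e^s-1}$ and $g(s,y)=\frac1{1-y(e^s-1)}$ as power series in $s$. Complexity is measured by the number of ring operations in the indicated rings. A commutative ring is said to support the fast Fourier transform (FFT) if it contains a primitive $2^k$-th root of unity for every nonnegative integer $k$; it is assumed throughout that FFT is feasible over the coefficient rings used (so that FFT-based power series arithmetic is available). Truncated products. Products of the form $e^{as}\prod_{b\in B_0}g(bs)\prod_{i=1}^r\prod_{b\in B_i}g(bs,y_i)\bmod\langle s^d\rangle$ (with $a\in\mathbb{Q}$, $B_i$ finite multisets of nonzero integers, $y_i$ in the coefficient ring) are computed by the log-exponential method: compute the truncated logarithms $\ln g(s)$ and $\ln g(s,y_i)$, form $H(s)=as+\sum_{b\in B_0}\ln g(bs)+\sum_{i}\sum_{b\in B_i}\ln g(bs,y_i)\bmod\langle s^d\rangle$, then compute $e^{H(s)}\bmod\langle s^d\rangle$. Algorithm Cyc-Denum. Input $\boldsymbol{a}$ and symbolic $t$. For each divisor $f$ of an entry of $\boldsymbol{a}$: - If $f=1$: compute $\prod_{i=1}^N g(a_is)\equiv\sum_{k=0}^{N-1}A_ks^k\pmod{\langle s^N\rangle}$ with $A_k\in\mathbb{Q}$ by the log-exponential method, and output $$W_1(t;\boldsymbol{a})=\Big[\sum_{m=0}^{N-1}\frac{(-1)^{N+m+1}}{m!\prod_{i=1}^Na_i}A_{N-1-m}t^m\Big].$$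 - If $f>1$, with $d=n(f\mid\boldsymbol{a})$: (i) compute $v_i(x)=\big\langle-\frac1f x^{a_i}\theta_f'(x^{a_i})\big\rangle_R$ for all $i$ with $f\nmid a_i$ (this depends only on $a_i\bmod f$); (ii) by the log-exponential method over $R$ (with $\zeta$ the class of $x$) compute $\widehat M_0,\dots,\widehat M_{d-1}$ with $$\prod_{i:f\mid a_i}g(a_is)\prod_{i:f\nmid a_i}g(a_is,v_i(\zeta)-1)\equiv\sum_{k=0}^{d-1}\widehat M_k(\zeta)s^k\pmod{\langle s^d\rangle};$$ (iii) for $0\le m\le d-1$ compute $M_m(x)=\big\langle\widehat M_{d-1-m}(x)\prod_{i:f\nmid a_i}v_i(x)\big\rangle_R$ and the coefficients $c_{m,i}$ in $M_m(x)\widehat\Phi_f(x)\Phi_f'(x)\equiv\sum_{i=0}^{f-1}c_{m,i}x^i\pmod{\langle x^f-1\rangle}$; (iv) output $W_f(t;\boldsymbol{a})=[P_1(t),\dots,P_f(t)]$ with $$P_i(t)=\sum_{m=0}^{d-1}\frac{(-1)^{d+m+1}}{m!\prod_{k:f\mid a_k}a_k}c_{m,i-1}t^m.$$ *)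

(* Defs.v *)
From HB Require Import structures.
From mathcomp Require Import all_boot all_order all_algebra all_field.
From mathcomp Require Import boolp.

Set Implicit Arguments.
Unset Strict Implicit.
Unset Printing Implicit Defensive.

Import Order.TTheory GRing.Theory Num.Theory.
Local Open Scope ring_scope.

(** * The Sylvester wave

    [C] is an arbitrary [numClosedFieldType], which covers the complex numbers.
    A formal power series is its sequence of coefficients [nat -> C], a formal
    Laurent series its family of coefficients [int -> C]. *)

Section Wave.
Context (C : numClosedFieldType).

Definition fps_exp (c : C) : nat -> C := fun n => c ^+ n / (n`!)%:R.

Definition fps_mul (u v : nat -> C) : nat -> C :=
  fun n => \sum_(i < n.+1) u i * v (n - i)%N.

(* The first n coefficients of u / v, for v 0 != 0: they solve q v = u. *)
Fixpoint fps_div_seq (u v : nat -> C) (n : nat) : seq C :=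
  if n is m.+1 then
    let q := fps_div_seq u v m in
    rcons q ((u m - \sum_(i < m) q`_i * v (m - i)%N) / v 0%N)
  else [::].

Definition fps_div (u v : nat -> C) : nat -> C :=
  fun n => (fps_div_seq u v n.+1)`_n.

Definition fps_order (v : nat -> C) : nat :=
  if pselect (exists n, v n != 0) is left nz then ex_minn nz else 0%N.

(* The Laurent expansion of u / v at 0: if v = s ^ o * w with w(0) != 0, then
   the coefficient of s ^ k in u / v is that of s ^ (k + o) in u / w. *)
Definition laurent_div (u v : nat -> C) : int -> C :=
  fun k =>
    let o := fps_order v in
    if k + o%:Z is Posz m then fps_div u (fun i => v (i + o)%N) m else 0.

Definition residue0 (F : int -> C) : C := F (-1).

(* The primitive f-th roots of unity, each listed once. *)
Definition prim_roots (f : nat) : seq C :=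
  [seq z <- undup (sval (closed_field_poly_normal ('X^f - 1 : {poly C})))
  | f.-primitive_root z].

(* 1 - z ^ b * exp (b s) *)
Definition wave_factor (z : C) (b : nat) : nat -> C :=
  fun n => (n == 0%N)%:R - z ^+ b * fps_exp b%:R n.

Definition wave_denom (z : C) (a : seq nat) : nat -> C :=
  foldr (fun b => fps_mul (wave_factor z b)) (fun n => (n == 0%N)%:R) a.

Definition sylvester_wave (f : nat) (a : seq nat) (t : nat) : C :=
  - residue0 (fun k => \sum_(z <- prim_roots f)
      laurent_div (fun n => z ^- t * fps_exp (- t%:R) n) (wave_denom z a) k).

End Wave.

(* P = [P_1, ..., P_f], with P_i stored at index i - 1. *)
Definition computes_wave (f : nat) (a : seq nat) (P : seq {poly rat}) : Prop :=
  size P = f /\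
  forall (C : numClosedFieldType) (t i : nat),
    (1 <= i <= f)%N -> t = i %[mod f] ->
    sylvester_wave C f a t = ratr (P`_i.-1).[t%:R].

(** * Counting ring operations

    A computation is its result together with the number of ring operations it
    performs.  Operations on indices and lists, and truncations, are free. *)

Definition comp (T : Type) : Type := (T * nat)%type.

Definition ret (T : Type) (x : T) : comp T := (x, 0%N).
Definition bind (S T : Type) (e : comp S) (k : S -> comp T) : comp T :=
  ((k e.1).1, (e.2 + (k e.1).2)%N).

Notation "x <-- e ;; k" := (bind e (fun x => k))
  (at level 100, e at next level, right associativity).

Fixpoint mapC (S T : Type) (F : S -> comp T) (s : seq S) : comp (seq T) :=
  if s is x :: s' then y <-- F x ;; r <-- mapC F s' ;; ret (y :: r)
  else ret [::].

Fixpoint foldC (S T : Type) (F : S -> T -> comp T) (s : seq S) (x : T) :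
  comp T := if s is y :: s' then z <-- F y x ;; foldC F s' z else ret x.

Section RingOps.
Context (A : comNzRingType).

Definition addC (x y : A) : comp A := (x + y, 1%N).
Definition subC (x y : A) : comp A := (x - y, 1%N).
Definition oppC (x : A) : comp A := (- x, 1%N).
Definition mulC (x y : A) : comp A := (x * y, 1%N).
Definition mulnC (x : A) (n : nat) : comp A := (n%:R * x, 1%N).

(* Division by a nonzero integer; emb makes A a Q-algebra. *)
Definition divnC (emb : {rmorphism rat -> A}) (x : A) (n : nat) : comp A :=
  (emb n%:R^-1 * x, 1%N).

Definition prodC (s : seq A) : comp A := foldC mulC s 1.

End RingOps.

Definition invQC (x : rat) : comp rat := (x^-1, 1%N).

(* max(1, ceil(log2 n)): the logarithm of the O-bounds, kept positive so that
   the bounds make sense at n = 1. *)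
Definition lg (n : nat) : nat := maxn 1 (up_log 2 n).

(* Feasibility of FFT over A: power series are multiplied modulo s ^ n with
   O(n log n) operations in A, c being the implied constant.  Containment of
   primitive 2 ^ k-th roots of unity for all k cannot be asked for literally,
   since rat has none for k > 1. *)
Record fft_mul (A : comNzRingType) (c : nat) := FFTMul {
  fmul :> nat -> {poly A} -> {poly A} -> comp {poly A};
  fmulE : forall n p q, (fmul n p q).1 = take_poly n (p * q);
  fmul_cost : forall n p q, (0 < n)%N -> ((fmul n p q).2 <= c * (n * lg n))%N
}.

(** * Truncated power series arithmetic

    Series modulo s ^ n are polynomials in s of size at most n. *)

Section Series.
Context (A : comNzRingType) (emb : {rmorphism rat -> A}).
Context (c : nat) (mul : fft_mul A c).

(* The series with i-th coefficient F i for i < n. *)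
Definition tabC (n : nat) (F : nat -> comp A) : comp {poly A} :=
  (\poly_(i < n) (F i).1, (\sum_(i < n) (F i).2)%N).

Definition addS n (p q : {poly A}) := tabC n (fun i => addC p`_i q`_i).
Definition subS n (p q : {poly A}) := tabC n (fun i => subC p`_i q`_i).
Definition oppS n (p : {poly A}) := tabC n (fun i => oppC p`_i).
Definition hadamardS n (p q : {poly A}) := tabC n (fun i => mulC p`_i q`_i).
Definition derivS n (p : {poly A}) := tabC n (fun i => mulnC p`_i.+1 i.+1).
Definition integS n (p : {poly A}) :=
  tabC n (fun i => if i is j.+1 then divnC emb p`_j i else ret 0).

(* Newton iteration: inverse modulo s ^ (2 ^ k) of p, for p(0) = 1. *)
Fixpoint invS (k : nat) (p : {poly A}) : comp {poly A} :=
  if k is j.+1 then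
    let n := (2 ^ k)%N in
    g <-- invS j p ;;
    e <-- mul n p g ;;
    e' <-- subS n 2%:R e ;;
    mul n g e'
  else ret 1.

(* ln p modulo s ^ (2 ^ k), for p(0) = 1. *)
Definition logS (k : nat) (p : {poly A}) : comp {poly A} :=
  let n := (2 ^ k)%N in
  g <-- invS k p ;;
  p' <-- derivS n p ;;
  h <-- mul n p' g ;;
  integS n h.

(* Newton iteration: exp h modulo s ^ (2 ^ k), for h(0) = 0. *)
Fixpoint expS (k : nat) (h : {poly A}) : comp {poly A} :=
  if k is j.+1 then
    let n := (2 ^ k)%N in
    e <-- expS j h ;;
    l <-- logS k e ;;
    r <-- subS n h l ;;
    r' <-- addS n 1 r ;;
    mul n e r'
  else ret 1.

(* 1/0!, ..., 1/(n-1)! *)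
Fixpoint inv_facts (n : nat) : comp (seq A) :=
  match n with
  | 0 => ret [::]
  | 1 => ret [:: 1]
  | m.+1 => s <-- inv_facts m ;; x <-- divnC emb (last 1 s) m ;; ret (rcons s x)
  end.

(* ln g(s) = - ln ((exp s - 1) / s) modulo s ^ (2 ^ k) *)
Definition ln_g (k : nat) : comp {poly A} :=
  let n := (2 ^ k)%N in
  e <-- inv_facts n.+1 ;;
  l <-- logS k (\poly_(i < n) e`_i.+1) ;;
  oppS n l.

(* ln g(s,y) = - ln (1 - y (exp s - 1)) modulo s ^ (2 ^ k) *)
Definition ln_gy (k : nat) (y : A) : comp {poly A} :=
  let n := (2 ^ k)%N in
  e <-- inv_facts n ;;
  u <-- tabC n (fun i => if i is 0 then ret 1
                         else z <-- mulC y e`_i ;; oppC z) ;;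
  l <-- logS k u ;;
  oppS n l.

(* Numerator and denominator of \sum_(b in B) 1 / (1 - b s), by divide and
   conquer; recursion depth size B is always sufficient. *)
Fixpoint frac_sum (depth : nat) (B : seq int) : comp ({poly A} * {poly A}) :=
  match B, depth with
  | [:: b], _ => x <-- oppC b%:~R ;; ret (1, Poly [:: 1; x])
  | _ :: _ :: _, j.+1 =>
      let n := size B in
      l <-- frac_sum j (take n./2 B) ;;
      r <-- frac_sum j (drop n./2 B) ;;
      x <-- mul n l.1 r.2 ;;
      y <-- mul n r.1 l.2 ;;
      num <-- addS n x y ;;
      den <-- mul n.+1 l.2 r.2 ;;
      ret (num, den)
  | _, _ => ret (0, 1)
  end.

(* \sum_i (\sum_(b in B) b ^ i) s ^ i modulo s ^ (2 ^ k), with B cut into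
   blocks of size 2 ^ k. *)
Definition power_sums (k : nat) (B : seq int) : comp {poly A} :=
  let n := (2 ^ k)%N in
  foldC (fun B' acc =>
      fr <-- frac_sum (size B') B' ;;
      g <-- invS k fr.2 ;;
      h <-- mul n fr.1 g ;;
      addS n acc h)
    (reshape (nseq (size B %/ n).+1 n) B) 0.

(* \sum_(b in B) L(b s) modulo s ^ (2 ^ k) *)
Definition sum_scaled (k : nat) (L : {poly A}) (B : seq int) : comp {poly A} :=
  p <-- power_sums k B ;; hadamardS (2 ^ k) L p.

(* The log-exponential method:
   exp (a s) * \prod_(b in B0) g(b s) * \prod_((y, B) in Bs) \prod_(b in B)
   g(b s, y) modulo s ^ d. *)
Definition log_exp (d : nat) (a : rat) (B0 : seq int) (Bs : seq (A * seq int)) :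
    comp {poly A} :=
  let k := up_log 2 d in
  let n := (2 ^ k)%N in
  L0 <-- ln_g k ;;
  H0 <-- sum_scaled k L0 B0 ;;
  H1 <-- foldC (fun yB acc =>
             L <-- ln_gy k yB.1 ;;
             S <-- sum_scaled k L yB.2 ;;
             addS n acc S) Bs H0 ;;
  H <-- addS n H1 (emb a *: 'X) ;;
  E <-- expS k H ;;
  ret (take_poly d E).

End Series.

(** * Algorithm Cyc-Denum *)

Definition signC (n : nat) (x : rat) : comp rat := if odd n then oppC x else ret x.

(* The case f = 1, over rat. *)
Definition cyc_denum1 (c : nat) (mul : fft_mul rat c) (a : seq nat) :
    comp (seq {poly rat}) :=
  let N := size a in
  A <-- log_exp idfun mul N 0 [seq b%:Z | b <- a] [::] ;;
  p <-- prodC [seq b%:R | b <- a] ;;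
  ip <-- invQC p ;;
  e <-- inv_facts idfun N ;;
  P <-- tabC N (fun m =>
          x <-- mulC e`_m ip ;;
          y <-- signC (N + m + 1) x ;;
          mulC y A`_(N - 1 - m)) ;;
  ret [:: P].

Definition cyclo (f : nat) : {poly rat} := map_poly intr 'Phi_f.
Definition cyclo_hat (f : nat) : {poly rat} := ('X^f - 1) %/ cyclo f.
Definition theta (f : nat) : {poly rat} := \poly_(i < f) 1.

(* R = Q[x]/<Phi_f> and S = Q[x]/<x^f - 1>; the underlying polynomial of an
   element is its standard form and in_qpoly is the reduction to it. *)
Definition ringR (f : nat) : comNzRingType := {poly %/ cyclo f}.
Definition ringS (f : nat) : comNzRingType := {poly %/ ('X^f - 1 : {poly rat})}.

Definition embR (f : nat) : {rmorphism rat -> ringR f} := qpolyC (cyclo f).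
Definition embS (f : nat) : {rmorphism rat -> ringS f} :=
  qpolyC ('X^f - 1 : {poly rat}).

(* Reducing an explicitly known polynomial to standard form is charged as one
   operation in the target ring. *)
Definition reduceR (f : nat) (p : {poly rat}) : comp (ringR f) :=
  (in_qpoly (cyclo f) p, 1%N).
Definition reduceS (f : nat) (p : {poly rat}) : comp (ringS f) :=
  (in_qpoly ('X^f - 1) p, 1%N).

Definition repR (f : nat) (x : ringR f) : {poly rat} := val x.
Definition repS (f : nat) (x : ringS f) : {poly rat} := val x.

Definition multiples (f : nat) (a : seq nat) := [seq b <- a | (f %| b)%N].
Definition nonmultiples (f : nat) (a : seq nat) := [seq b <- a | ~~ (f %| b)%N].

(* The elements M_0, ..., M_(d-1) of R.  The v_i, equal to 1 / (1 - x ^ a_i)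
   in R, are computed once for each occurring residue r = a_i %% f. *)
Definition cyc_denum_R (f c : nat) (mul : fft_mul (ringR f) c) (a : seq nat) :
    comp (seq (ringR f)) :=
  let d := size (multiples f a) in
  let rs := undup [seq b %% f | b <- nonmultiples f a]%N in
  v <-- mapC (fun r => reduceR f
          (- (f%:R)^-1 *: ('X^r * ((theta f)^`() \Po 'X^r)))) rs ;;
  y <-- mapC (fun w => subC w 1) v ;;
  Mhat <-- log_exp (embR f) mul d 0 [seq b%:Z | b <- multiples f a]
             (zip y [seq [seq b%:Z | b <- a & (b %% f == r)%N] | r <- rs]) ;;
  pv <-- prodC [seq v`_(index (b %% f)%N rs) | b <- nonmultiples f a] ;;
  mapC (fun m => mulC Mhat`_(d - 1 - m) pv) (iota 0 d).

(* From the M_m to the polynomials P_1, ..., P_f; the i-th coefficient of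
   cm is c_(m, i).  The operations on the rational scalars are charged as
   operations in S. *)
Definition cyc_denum_S (f : nat) (a : seq nat) (M : seq (ringR f)) :
    comp (seq {poly rat}) :=
  let d := size (multiples f a) in
  w1 <-- reduceS f (cyclo_hat f) ;;
  w2 <-- reduceS f (cyclo f)^`() ;;
  w <-- mulC w1 w2 ;;
  p <-- prodC [seq b%:R | b <- multiples f a] ;;
  ip <-- invQC p ;;
  e <-- inv_facts idfun d ;;
  Q <-- mapC (fun m =>
          Mm <-- reduceS f (repR M`_m) ;;
          cm <-- mulC Mm w ;;
          x <-- mulC e`_m ip ;;
          s <-- signC (d + m + 1) x ;;
          mulC (embS f s) cm) (iota 0 d) ;;
  ret (mkseq (fun i => \poly_(m < d) (repS Q`_m)`_i) f).

Record cyc_denum_result := CycDenumResult {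
  output : seq {poly rat};
  opsS : nat;
  opsR : nat
}.

Definition cyc_denum (f c : nat) (mul : fft_mul (ringR f) c) (a : seq nat) :
    cyc_denum_result :=
  let M := cyc_denum_R mul a in
  let P := cyc_denum_S a M.1 in
  CycDenumResult P.1 P.2 M.2.

(* Main.v *)
(** A power series L with L(0) = 0 is the logarithm of p, p(0) = 1, exactly when
    L' p = p'.  With this characterisation Newton's iterations for inverse and
    exponential, and hence the log-exponential method, are verified by
    differentiating: its output E satisfies E D = 1 mod s^d, where D is the
    product of the series (e^(bs) - 1) / (bs) and 1 - y (e^(bs) - 1).

    At a primitive f-th root of unity z the denominator of the wave is a nonzero
    constant times s^d D, so that E gives the residue; evaluation at z is a ring
    morphism from Q[x]/<Phi_f>, which transports E from R to the field of z.  The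
    polynomial M hatPhi Phi' takes the value f M(z) / z at the primitive roots of
    unity and 0 at the others, so the sum over z is read off by an inverse
    discrete Fourier transform.

    For the cost, Newton's iterations are geometric sums of costs n log n, and
    the divide and conquer on a block of m integers costs O(m log^2 m) with
    m <= n.  The residue classes of the a_i modulo f give at most f + N/n blocks,
    of total size at most N, whence f d log d + N log^2 d. *)
Require Import Defs.
From HB Require Import structures.
From mathcomp Require Import all_boot all_order all_algebra all_field.
From mathcomp Require Import ring zify boolp.

Set Implicit Arguments.
Unset Strict Implicit.
Unset Printing Implicit Defensive.

Import Order.TTheory GRing.Theory Num.Theory.
Local Open Scope ring_scope.

(** * Truncated power series *)

Section CongruenceModXn.
Context (A : comNzRingType).
Implicit Types (p q r u v : {poly A}) (n m : nat).

Definition eqm n p q := forall i, (i < n)%N -> p`_i = q`_i.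

Lemma eqm_sym n p q : eqm n p q -> eqm n q p.
Proof. by move=> e i /e. Qed.

Lemma eqm_trans n q p r : eqm n p q -> eqm n q r -> eqm n p r.
Proof. by move=> e f i li; rewrite e ?f. Qed.

Lemma eqmW m n p q : (m <= n)%N -> eqm n p q -> eqm m p q.
Proof. by move=> le e i li; apply: e; apply: leq_trans le. Qed.

Lemma eqmD n p q p' q' : eqm n p p' -> eqm n q q' -> eqm n (p + q) (p' + q').
Proof. by move=> e f i li; rewrite !coefD e ?f. Qed.

Lemma eqmN n p q : eqm n p q -> eqm n (- p) (- q).
Proof. by move=> e i li; rewrite !coefN e. Qed.

Lemma eqmB n p q p' q' : eqm n p p' -> eqm n q q' -> eqm n (p - q) (p' - q').
Proof. by move=> e f; apply: eqmD => //; apply: eqmN. Qed.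

Lemma eqmM n p q p' q' : eqm n p p' -> eqm n q q' -> eqm n (p * q) (p' * q').
Proof.
move=> e f i li; rewrite !coefM; apply: eq_bigr => j _.
by rewrite e ?f //; apply: leq_ltn_trans li; rewrite ?leq_subr // -ltnS.
Qed.

Lemma eqmZ n a p q : eqm n p q -> eqm n (a *: p) (a *: q).
Proof. by move=> e i li; rewrite !coefZ e. Qed.

Lemma eqm_prod (I : Type) (s : seq I) n (F G : I -> {poly A}) :
  (forall i, eqm n (F i) (G i)) -> eqm n (\prod_(i <- s) F i) (\prod_(i <- s) G i).
Proof. by move=> e; elim/big_ind2: _ => // *; apply: eqmM. Qed.

Lemma eqm_deriv n p q : eqm n p q -> eqm n.-1 p^`() q^`().
Proof. by move=> e i li; rewrite !coef_deriv e //; case: n li {e}. Qed.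

Lemma coef_comp_scaleX p b i : (p \Po (b *: 'X))`_i = b ^+ i * p`_i.
Proof.
rewrite comp_polyE coef_sum.
under eq_bigr => j _ do rewrite exprZn scalerA coefZ coefXn.
have [li|ge] := ltnP i (size p); last first.
  rewrite [p`_i]nth_default // mulr0 big1 // => j _.
  by rewrite gtn_eqF ?mulr0 //; apply: leq_trans ge.
rewrite (bigD1 (Ordinal li)) //= eqxx mulr1 big1 ?addr0 1?mulrC // => j.
by rewrite -val_eqE /= eq_sym => /negPf->; rewrite mulr0.
Qed.

Lemma eqm_scaleX n b p q :
  eqm n p q -> eqm n (p \Po (b *: 'X)) (q \Po (b *: 'X)).
Proof. by move=> e i li; rewrite !coef_comp_scaleX e. Qed.

Lemma eqm_take n p : eqm n (take_poly n p) p.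
Proof. by move=> i li; rewrite coef_take_poly li. Qed.

Lemma eqm_poly n E p : (forall i, (i < n)%N -> E i = p`_i) ->
  eqm n (\poly_(i < n) E i) p.
Proof. by move=> e i li; rewrite coef_poly li e. Qed.

(** Orders of vanishing add under multiplication. This is the source of the doubling of precision in
    both Newton iterations. *)
Lemma eqm0M m n p q : eqm m p 0 -> eqm n q 0 -> eqm (m + n) (p * q) 0.
Proof.
move=> e f i li; rewrite coefM coef0 big1 // => j _.
have [lj|gj] := ltnP j m; first by rewrite e // coef0 mul0r.
rewrite f ?coef0 ?mulr0 // ltn_subLR; last by rewrite -ltnS.
by apply: leq_trans li _; rewrite leq_add2r.
Qed.

(** A series with constant term 1 cancels over any commutative ring: in the coefficient of s^k of
    [r * p], the coefficient of index k of [p] appears with factor 1 and the other coefficients of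
    [p] have smaller index. *)
Lemma eqm_mull_inj n p q r : r`_0 = 1 -> eqm n (r * p) (r * q) -> eqm n p q.
Proof.
move=> r0 e; suff f k : (k <= n)%N -> eqm k p q by apply: f.
elim: k => [|k IH] // lk i; rewrite ltnS leq_eqVlt => /orP[/eqP->|]; last first.
  exact: IH (ltnW lk) _.
have := e k lk; rewrite !coefM !big_ord_recl !subn0 r0 !mul1r.
suff -> : \sum_(j < k) r`_(lift ord0 j) * p`_(k - lift ord0 j) =
          \sum_(j < k) r`_(lift ord0 j) * q`_(k - lift ord0 j) by exact: addIr.
apply: eq_bigr => j _; rewrite (IH (ltnW lk)) // lift0 ltn_subrL /=.
exact: leq_ltn_trans (ltn_ord j).
Qed.

End CongruenceModXn.

(** * Formal logarithms over a Q-algebra *)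

Section Logarithm.
Context (A : comNzRingType) (emb : {rmorphism rat -> A}).
Implicit Types (p q h L M : {poly A}) (n m : nat).

(* The differential equation L' p = p' characterises L = ln p in characteristic 0
   and needs neither composition of series nor the functional equation. *)
Definition is_log n p L :=
  [/\ p`_0 = 1, L`_0 = 0 & eqm n.-1 (L^`() * p) p^`()].

Lemma emb_natVK n (x : A) : (0 < n)%N -> emb n%:R^-1 * (n%:R * x) = x.
Proof.
move=> n0; rewrite mulrA -(rmorph_nat emb) -rmorphM mulVf ?rmorph1 ?mul1r //.
by rewrite pnatr_eq0 -lt0n.
Qed.

Lemma natr_emb_VK n (x : A) : (0 < n)%N -> n%:R * (emb n%:R^-1 * x) = x.
Proof. by move=> n0; rewrite mulrCA emb_natVK. Qed.

Lemma eqm_primitive n p q : p`_0 = q`_0 -> eqm n.-1 p^`() q^`() -> eqm n p q.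
Proof.
move=> e0 e [|i] // li; have: (i < n.-1)%N by case: n li {e}.
move/e; rewrite !coef_deriv -[p`_ _ *+ _]mulr_natl -[q`_ _ *+ _]mulr_natl.
move=> /(congr1 ( *%R (emb i.+1%:R^-1))).
by rewrite !emb_natVK.
Qed.

Lemma is_log_eqm n p q L M : (0 < n)%N ->
  is_log n p L -> eqm n p q -> eqm n L M -> is_log n q M.
Proof.
move=> n0 [p0 L0 e] epq eLM; split; rewrite -?epq -?eLM //.
apply: eqm_trans (eqm_deriv epq); apply: eqm_trans e.
by apply: eqmM; [apply: eqm_deriv; apply: eqm_sym
                |apply: eqmW (eqm_sym epq); apply: leq_pred].
Qed.

Lemma is_logM n p q L M :
  is_log n p L -> is_log n q M -> is_log n (p * q) (L + M).
Proof.
move=> [p0 L0 e] [q0 M0 f]; split.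
- by rewrite coefM big_ord1 p0 q0 mulr1.
- by rewrite coefD L0 M0 addr0.
rewrite derivD derivM.
have -> : (L^`() + M^`()) * (p * q) = L^`() * p * q + p * (M^`() * q) by ring.
by apply: eqmD; apply: eqmM.
Qed.

Lemma is_log1 n : is_log n 1 0.
Proof. by split; rewrite ?coef1 ?coef0 // deriv0 mul0r derivC. Qed.

Lemma is_log_prod (I : Type) (s : seq I) n (F G : I -> {poly A}) :
  (forall i, is_log n (F i) (G i)) ->
  is_log n (\prod_(i <- s) F i) (\sum_(i <- s) G i).
Proof.
move=> e; elim: s => [|x s IH]; first by rewrite !big_nil; apply: is_log1.
by rewrite !big_cons; apply: is_logM.
Qed.

Lemma is_log_scaleX n b p L :
  is_log n p L -> is_log n (p \Po (b *: 'X)) (L \Po (b *: 'X)).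
Proof.
move=> [p0 L0 e]; split; rewrite ?coef_comp_scaleX ?mul1r //.
rewrite !deriv_comp mulrAC -comp_polyM derivZ derivX.
by apply: eqmM => //; apply: eqm_scaleX.
Qed.

(** The equation p' = L' p with p(0) = 1 determines p: knowing p modulo s^k gives p' modulo s^k, and
    integrating gives p modulo s^(k+1). *)
Lemma is_log_inj n p q L : is_log n p L -> is_log n q L -> eqm n p q.
Proof.
move=> [p0 _ e] [q0 _ f]; suff g k : (k <= n)%N -> eqm k p q by apply: g.
elim: k => [|k IH] // lk; apply: eqm_primitive; first by rewrite p0.
have le1 : (k <= n.-1)%N by case: n lk {e f IH}.
apply: eqm_trans (eqmW le1 f); apply: eqm_trans (eqm_sym (eqmW le1 e)) _.
by apply: eqmM => //; apply: IH; apply: ltnW.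
Qed.

Lemma is_log_fun n p L M : is_log n p L -> is_log n p M -> eqm n L M.
Proof.
move=> [p0 L0 e] [_ M0 f]; apply: eqm_primitive; first by rewrite L0.
apply: (eqm_mull_inj p0); rewrite ![p * _]mulrC.
exact: eqm_trans e (eqm_sym f).
Qed.

(** * Newton's iterations for inverse, logarithm and exponential *)

Context (c : nat) (mul : fft_mul A c).

Lemma eqm_fmul n p q : eqm n (mul n p q).1 (p * q).
Proof. by rewrite fmulE; apply: eqm_take. Qed.

Lemma eqm_addS n p q : eqm n (addS n p q).1 (p + q).
Proof. by apply: eqm_poly => i _; rewrite coefD. Qed.

Lemma eqm_subS n p q : eqm n (subS n p q).1 (p - q).
Proof. by apply: eqm_poly => i _; rewrite coefB. Qed.

Lemma eqm_oppS n p : eqm n (oppS n p).1 (- p).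
Proof. by apply: eqm_poly => i _; rewrite coefN. Qed.

Lemma invS_correct k p : p`_0 = 1 -> eqm (2 ^ k) (p * (invS mul k p).1) 1.
Proof.
move=> p0; elim: k => [|k IH].
  by move=> [|] // _; rewrite mulr1 p0 coef1.
rewrite /=; set g := (invS mul k p).1; set n := (2 ^ k.+1)%N.
have e : eqm n (p * (mul n g (subS n 2%:R (mul n p g).1).1).1)
               (p * (g * (2%:R - p * g))).
  apply: eqmM => //; apply: eqm_trans (eqm_fmul _ _) _; apply: eqmM => //.
  apply: eqm_trans (eqm_subS _ _) _; apply: eqmB => //; exact: eqm_fmul.
apply: eqm_trans e _.
(* The error of the new approximation is the square of the old one. *)
have -> : p * (g * (2%:R - p * g)) = 1 - (p * g - 1) * (p * g - 1) by ring.
have f : eqm (2 ^ k) (p * g - 1) 0 by rewrite -(subrr 1); apply: eqmB.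
rewrite -[X in eqm n _ X]subr0; apply: eqmB => //.
by rewrite /n expnS mul2n -addnn; apply: eqm0M.
Qed.

Lemma logS_correct k p : p`_0 = 1 -> is_log (2 ^ k) p (logS emb mul k p).1.
Proof.
move=> p0; split=> //.
  by rewrite /= coef_poly expn_gt0.
set n := (2 ^ k)%N; rewrite /logS -/n /=; set h := (mul _ _ _).1.
apply: (@eqm_trans _ _ (h * p)).
  apply: eqmM => // i li; rewrite coef_deriv coef_poly.
  have -> : (i.+1 < n)%N by rewrite -ltn_predRL.
  by rewrite /= -[LHS]mulr_natl natr_emb_VK.
apply: (@eqm_trans _ _ (p^`() * (p * (invS mul k p).1))).
  rewrite mulrC (mulrCA p^`()); apply: eqmM => //.
  apply: eqmW (leq_pred _) _; apply: eqm_trans (eqm_fmul _ _) _.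
  by apply: eqmM => //; apply: eqm_poly => i _; rewrite coef_deriv mulr_natl.
rewrite -[X in eqm _ _ X]mulr1; apply: eqmM => //.
exact: eqmW (leq_pred _) (invS_correct p0).
Qed.

(* If L' e = e' and h = L + r then (e (1 + r))' = h' e (1 + r) - r' e r, so the
   precision doubles. *)
Lemma expS_correct k h : h`_0 = 0 -> is_log (2 ^ k) (expS emb mul k h).1 h.
Proof.
move=> h0; elim: k => [|k IH].
  by split; rewrite ?coef1.
rewrite /=; set e := (expS emb mul k h).1; set n := (2 ^ k.+1)%N.
have n0 : (0 < n)%N by rewrite expn_gt0.
have e0 : e`_0 = 1 by case: IH.
have lL := @logS_correct k.+1 _ e0; rewrite -/n in lL *.
set L := (logS emb mul k.+1 e).1 in lL *.
set r := (subS n h L).1; set s := (addS n 1 r).1; set E := (mul n e s).1.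
have le2 : (2 ^ k <= n)%N by rewrite leq_exp2l.
have er : eqm n r (h - L) by apply: eqm_subS.
have eE : eqm n E (e * (1 + (h - L))).
  apply: eqm_trans (eqm_fmul _ _) _; apply: eqmM => //.
  by apply: eqm_trans (eqm_addS _ _) _; apply: eqmD.
suff: is_log n (e * (1 + (h - L))) h.
  by move=> lh; apply: is_log_eqm lh _ _ => //; apply: eqm_sym.
have L0 : L`_0 = 0 by case: lL.
(* By induction [h] is a logarithm of [e] modulo s^(2^k); so is [L], and logarithms are unique. *)
have hL : eqm (2 ^ k) (h - L) 0.
  rewrite -(subrr L); apply: eqmB => //; apply: is_log_fun IH _.
  have [_ _ f] := lL; split=> //.
  by apply: eqmW f; rewrite -!subn1 leq_sub2r.
split=> //; first by rewrite coefM big_ord1 e0 coefD coef1 coefB h0 L0 subrr addr0 mul1r.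
rewrite derivM derivD derivC add0r derivB.
have -> : h^`() * (e * (1 + (h - L))) =
  L^`() * e * (1 + (h - L)) + e * (h^`() - L^`())
  + e * ((h^`() - L^`()) * (h - L)) by ring.
rewrite -[X in eqm _ _ X]addr0; apply: eqmD; last first.
  rewrite -(mulr0 e); apply: eqmM => //.
  (* The remaining term is e (h' - L') (h - L). Its factors vanish to orders 2^k - 1 and 2^k, and
     the sum of these is exactly the precision that [is_log] asks of the derivatives. *)
  have -> : n.-1 = ((2 ^ k).-1 + 2 ^ k)%N.
    by rewrite /n expnS mul2n -addnn; case: (2 ^ k)%N (expn_gt0 2 k).
  by apply: eqm0M => //; rewrite -derivB -(deriv0 A); apply: eqm_deriv.
by apply: eqmD => //; apply: eqmM => //; case: lL.
Qed.

(** * Logarithms of g(s) and g(s,y) *)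

Lemma inv_factsE n : (inv_facts emb n).1 = mkseq (fun i => emb i`!%:R^-1) n.
Proof.
case: n => [|n] //; elim: n => [|n IH]; first by rewrite /mkseq /= fact0 invr1 rmorph1.
rewrite [LHS]/= -/(inv_facts emb n.+1) IH [RHS]mkseqS; congr rcons.
rewrite /mkseq -nth_last size_map size_iota (nth_map 0%N) ?size_iota // nth_iota //.
by rewrite add0n factS natrM invfM rmorphM.
Qed.

Lemma nth_inv_facts n i :
  (i < n)%N -> (inv_facts emb n).1`_i = emb i`!%:R^-1.
Proof. by move=> li; rewrite inv_factsE nth_mkseq. Qed.

Definition exp_series n : {poly A} := \poly_(i < n) emb i`!%:R^-1.

(* (exp s - 1) / s = 1 / g(s) *)
Definition g_inv n : {poly A} := \poly_(i < n) emb i.+1`!%:R^-1.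

(* 1 - y (exp s - 1) = 1 / g(s, y) *)
Definition gy_inv n (y : A) : {poly A} := 1 - y *: (exp_series n - 1).

(** The reciprocal of g, unlike g itself, has explicit coefficients, so the logarithm is stated for
    the reciprocal, with the opposite sign. *)
Lemma ln_g_correct k :
  is_log (2 ^ k) (g_inv (2 ^ k)) (- (ln_g emb mul k).1).
Proof.
set n := (2 ^ k)%N; have n0 : (0 < n)%N by rewrite expn_gt0.
pose p := \poly_(i < n) (inv_facts emb n.+1).1`_i.+1.
change (is_log n (g_inv n) (- (oppS n (logS emb mul k p).1).1)).
have ep : p = g_inv n by apply: eq_poly => i li; rewrite nth_inv_facts.
have p0 : p`_0 = 1 by rewrite ep coef_poly n0 factS fact0 muln1 invr1 rmorph1.
have lL := @logS_correct k _ p0; rewrite -ep; apply: is_log_eqm lL _ _ => //.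
by move=> i li; rewrite coefN eqm_oppS // coefN opprK.
Qed.

Lemma ln_gy_correct k y :
  is_log (2 ^ k) (gy_inv (2 ^ k) y) (- (ln_gy emb mul k y).1).
Proof.
set n := (2 ^ k)%N; have n0 : (0 < n)%N by rewrite expn_gt0.
pose u := tabC n (fun i => if i is 0 then ret 1
                           else z <-- Defs.mulC y (inv_facts emb n).1`_i ;; Defs.oppC z).
change (is_log n (gy_inv n y) (- (oppS n (logS emb mul k u.1).1).1)).
have ep : eqm n u.1 (gy_inv n y).
  apply: eqm_poly => -[|i] li /=; rewrite /gy_inv coefB coef1 coefZ coefB coef1;
    rewrite coef_poly li /= ?mulr1n ?mulr0n.
    by rewrite invr1 rmorph1 subrr mulr0 subr0.
  by rewrite nth_inv_facts // sub0r subr0.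
have p0 : u.1`_0 = 1 by rewrite coef_poly n0.
have lL := @logS_correct k _ p0; apply: is_log_eqm lL _ _ => //.
by move=> i li; rewrite coefN eqm_oppS // coefN opprK.
Qed.

(** This is the sum of the geometric series 1 / (1 - b s) modulo s^n; its coefficients are the power
    sums of [B]. *)
Definition psum n (B : seq int) : {poly A} :=
  \sum_(b <- B) \poly_(i < n) b%:~R ^+ i.

Lemma psum_cat n B1 B2 : psum n (B1 ++ B2) = psum n B1 + psum n B2.
Proof. exact: big_cat. Qed.

(** The size bounds make the truncated products in the recursion exact. Hence the quotient of the
    two polynomials is the sum of the 1 / (1 - b s) to every precision, not only modulo a fixed
    power of s. *)
Lemma frac_sum_correct depth B : (size B <= depth)%N ->
  let fr := (frac_sum mul depth B).1 in
  [/\ (size fr.1 <= size B)%N, (size fr.2 <= (size B).+1)%N, fr.2`_0 = 1 &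
      forall n, eqm n fr.1 (fr.2 * psum n B)].
Proof.
elim: depth B => [|j IH] [|b [|b' B]] // leB.
- by split; rewrite ?size_poly0 ?size_poly1 ?coef1 // => n; rewrite /psum big_nil mulr0.
- by split; rewrite ?size_poly0 ?size_poly1 ?coef1 // => n; rewrite /psum big_nil mulr0.
- pose P : {poly A} := Poly [:: 1; - b%:~R].
  change [/\ (size (1%R : {poly A}) <= 1)%N, (size P <= 2)%N, P`_0 = 1 &
             forall n, eqm n (1 : {poly A}) (P * psum n [:: b])].
  rewrite size_poly1 size_Poly coef_Poly; split=> // n i li.
  have -> : P = 1 - b%:~R *: 'X.
    apply/polyP=> -[|[|?]]; rewrite coef_Poly coefB coef1 coefZ coefX /=.
    - by rewrite mulr0 subr0.
    - by rewrite mulr1 sub0r.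
    - by rewrite mulr0 subr0 nth_nil.
  (* For a single b, (1 - b s) times the truncated geometric series telescopes to 1 below s^n. *)
  rewrite /psum big_seq1 coef1 mulrBl mul1r coefB -scalerAl coefZ coefXM.
  rewrite coef_poly li; case: i li => [|i] li /=; first by rewrite mulr0 subr0.
  by rewrite coef_poly (ltnW li) exprS subrr.
set BB := [:: b, b' & B] in leB *; set n := size BB.
have n2 : (n./2 < n)%N by rewrite ltn_half_double -addnn -[X in (X < _)%N]addn0 ltn_add2l.
have szl : size (take n./2 BB) = n./2 by rewrite size_takel // ltnW.
have szr : size (drop n./2 BB) = (n - n./2)%N by rewrite size_drop.
have [|] := IH (take n./2 BB); first by rewrite szl -ltnS (leq_trans n2).
rewrite szl; set l := (frac_sum mul j (take n./2 BB)).1 => l1 l2 l0 lS.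
have [|] := IH (drop n./2 BB).
  by rewrite szr leq_subLR (leq_trans leB) // -addn1 addnC leq_add2r.
rewrite szr; set r := (frac_sum mul j (drop n./2 BB)).1 => r1 r2 r0 rS.
have n0 : (0 < n - n./2)%N by rewrite subn_gt0.
have h0 : (0 < n./2)%N by [].
change (let fr := ((addS n (mul n l.1 r.2).1 (mul n r.1 l.2).1).1,
                   (mul n.+1 l.2 r.2).1) in
  [/\ (size fr.1 <= n)%N, (size fr.2 <= n.+1)%N, fr.2`_0 = 1 &
      forall m, eqm m fr.1 (fr.2 * psum m BB)]) => /=.
have nE : (n./2 + (n - n./2) = n)%N by rewrite subnKC // ltnW.
have sM p q s t m : (size p <= s)%N -> (size q <= t)%N -> (s + t <= m.+1)%N ->
  (size (p * q)%R <= m)%N.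
  move=> sp sq ab; rewrite (leq_trans (size_polyMleq _ _)) // -subn1 leq_subLR.
  by rewrite add1n (leq_trans _ ab) // leq_add.
have sx : (size (l.1 * r.2)%R <= n)%N by apply: sM l1 r2 _; rewrite addnS nE.
have sy : (size (r.1 * l.2)%R <= n)%N by apply: sM r1 l2 _; rewrite addnS addnC nE.
have sd : (size (l.2 * r.2)%R <= n.+1)%N.
  by apply: sM l2 r2 _; rewrite addSn addnS nE.
rewrite !fmulE !take_poly_id //; split; rewrite ?size_poly //.
  by rewrite coefM big_ord1 l0 r0 mulr1.
move=> m; apply: (@eqm_trans _ _ (l.1 * r.2 + r.1 * l.2)).
  move=> i _; rewrite coef_poly coefD; case: ltnP => // ge.
  by rewrite !nth_default ?addr0 //; apply: leq_trans ge.
rewrite -(cat_take_drop n./2 BB) psum_cat.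
have -> : l.2 * r.2 * (psum m (take n./2 BB) + psum m (drop n./2 BB)) =
  l.2 * psum m (take n./2 BB) * r.2 + r.2 * psum m (drop n./2 BB) * l.2 by ring.
by apply: eqmD; apply: eqmM.
Qed.

Lemma fst_foldC (S T : Type) (F : S -> T -> Defs.comp T) s x :
  (foldC F s x).1 = foldl (fun z y => (F y z).1) x s.
Proof. by elim: s x => //= y s IH x; rewrite IH. Qed.

Lemma power_sums_correct k B :
  eqm (2 ^ k) (power_sums mul k B).1 (psum (2 ^ k) B).
Proof.
rewrite /power_sums fst_foldC; set n := (2 ^ k)%N.
set F := fun _ _ => _; set bs := reshape _ _.
(* The blocks have total capacity ([size B %/ n] + 1) n, which exceeds [size B], so nothing of [B]
   is dropped. *)
have <- : flatten bs = B.
  rewrite reshapeKr // sumn_nseq mulnC; apply: ltnW.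
  by apply: ltn_ceil; rewrite expn_gt0.
suff H acc : eqm n (foldl F acc bs) (acc + psum n (flatten bs)) by rewrite -[X in eqm _ _ X]add0r.
elim: bs acc => [|b bs IH] acc; first by rewrite /psum big_nil addr0.
rewrite /= psum_cat addrA; apply: eqm_trans (IH _) _; apply: eqmD => //.
apply: eqm_trans (eqm_addS _ _) _; apply: eqmD => //.
apply: eqm_trans (eqm_fmul _ _) _.
have [_ _ b0 bS] := frac_sum_correct (leqnn (size b)).
(* The denominator has constant term 1 and can be cancelled, so both sides are compared after
   multiplication by it; there its product with its Newton inverse becomes 1. *)
set fr := (frac_sum _ _ _).1 in b0 bS *; apply: (eqm_mull_inj b0).
have e := @invS_correct k _ b0; rewrite -/n in e.
set g := (invS mul k fr.2).1 in e *.
have -> : fr.2 * (fr.1 * g) = fr.1 * (fr.2 * g) by ring.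
apply: eqm_trans (_ : eqm n (fr.1 * 1) _); first exact: eqmM.
by rewrite mulr1.
Qed.

(** The coefficient of s^i in L(b s) is b^i times that of L, so summing over b multiplies it by the
    i-th power sum. *)
Lemma sum_scaled_correct k (L : {poly A}) B :
  eqm (2 ^ k) (sum_scaled mul k L B).1 (\sum_(b <- B) (L \Po (b%:~R *: 'X))).
Proof.
rewrite /sum_scaled; set n := (2 ^ k)%N.
change (eqm n (hadamardS n L (power_sums mul k B).1).1
              (\sum_(b <- B) (L \Po (b%:~R *: 'X)))).
apply: eqm_poly => i li; rewrite power_sums_correct // /psum !coef_sum.
change (L`_i * (\sum_(b <- B) (\poly_(j < n) b%:~R ^+ j)`_i) =
        \sum_(b <- B) (L \Po (b%:~R *: 'X))`_i).
rewrite mulr_sumr; apply: eq_bigr => b _.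
by rewrite coef_comp_scaleX coef_poly li mulrC.
Qed.

Definition prod_inv n (B0 : seq int) (Bs : seq (A * seq int)) : {poly A} :=
  (\prod_(b <- B0) (g_inv n \Po (b%:~R *: 'X))) *
  \prod_(yB <- Bs) \prod_(b <- yB.2) (gy_inv n yB.1 \Po (b%:~R *: 'X)).

Lemma eqm_g_inv m n : (m <= n)%N -> eqm m (g_inv m) (g_inv n).
Proof.
by move=> le i li; rewrite !coef_poly li (leq_trans li le).
Qed.

Lemma eqm_gy_inv m n y : (m <= n)%N -> eqm m (gy_inv m y) (gy_inv n y).
Proof.
move=> le; apply: eqmB => //; apply: eqmZ; apply: eqmB => // i li.
by rewrite !coef_poly li (leq_trans li le).
Qed.

Lemma eqm_prod_inv m n B0 Bs :
  (m <= n)%N -> eqm m (prod_inv m B0 Bs) (prod_inv n B0 Bs).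
Proof.
move=> le; apply: eqmM; apply: eqm_prod => x.
  by apply: eqm_scaleX; apply: eqm_g_inv.
by apply: eqm_prod => b; apply: eqm_scaleX; apply: eqm_gy_inv.
Qed.

(** The exponential has logarithm [HH] and the reciprocal product has logarithm [- HH]; their
    product has logarithm 0, as 1 does, and a series is determined by its logarithm. The precision
    [n] of the reciprocal is left free above [d] because the residue computation uses 2d. *)
Lemma log_exp_correct d n B0 Bs : (d <= n)%N ->
  eqm d ((log_exp emb mul d 0 B0 Bs).1 * prod_inv n B0 Bs) 1.
Proof.
move=> ledn; set k := up_log 2 d; set m := (2 ^ k)%N.
have ledm : (d <= m)%N by apply: up_logP.
pose H0 := sum_scaled mul k (ln_g emb mul k).1 B0.
pose H1 := foldC (fun yB acc =>
             L <-- ln_gy emb mul k yB.1 ;;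
             S <-- sum_scaled mul k L yB.2 ;;
             addS m acc S) Bs H0.1.
pose H := addS m H1.1 (emb 0 *: 'X).
suff: eqm d ((expS emb mul k H.1).1 * prod_inv n B0 Bs) 1.
  by apply: eqm_trans; apply: eqmM => //; apply: eqm_take.
(* The algorithm works modulo s^m with m the power of two above d; truncating the reciprocal at m or
   at n gives the same series modulo s^d. *)
have e : eqm d (prod_inv n B0 Bs) (prod_inv m B0 Bs).
  by apply: eqm_trans (eqm_prod_inv _ _ ledm); apply/eqm_sym/eqm_prod_inv.
apply: (@eqm_trans _ _ ((expS emb mul k H.1).1 * prod_inv m B0 Bs)).
  exact: eqmM.
apply: eqmW ledm _.
pose L b := (ln_g emb mul k).1 \Po (b%:~R *: 'X).
pose Ly y b := (ln_gy emb mul k y).1 \Po (b%:~R *: 'X).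
pose HH := \sum_(b <- B0) L b + \sum_(yB <- Bs) \sum_(b <- yB.2) Ly yB.1 b.
have logD : is_log m (prod_inv m B0 Bs) (- HH).
  rewrite opprD -!sumrN; apply: is_logM; apply: is_log_prod => x.
    by rewrite -raddfN; apply: is_log_scaleX; apply: ln_g_correct.
  rewrite -sumrN; apply: is_log_prod => b.
  by rewrite -raddfN; apply: is_log_scaleX; apply: ln_gy_correct.
have HE : eqm m H.1 HH.
  rewrite /H; apply: eqm_trans (eqm_addS _ _) _.
  rewrite rmorph0 scale0r addr0 /H1 fst_foldC.
  have : eqm m H0.1 (\sum_(b <- B0) L b) by apply: sum_scaled_correct.
  rewrite /HH; elim: (Bs) (H0.1) (\sum_(b <- B0) L b) => [|yB s IH] acc acc' e'.
    by rewrite big_nil addr0.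
  rewrite /= big_cons addrA; apply: IH; apply: eqm_trans (eqm_addS _ _) _.
  by apply: eqmD => //; apply: sum_scaled_correct.
have m0 : (0 < m)%N by rewrite expn_gt0.
have HH0 : HH`_0 = 0 by case: logD => _; rewrite coefN => /eqP; rewrite oppr_eq0 => /eqP.
have logE : is_log m (expS emb mul k H.1).1 H.1.
  by apply: expS_correct; rewrite HE.
apply: (@is_log_inj _ _ _ 0) (is_log1 m).
apply: is_log_eqm (is_logM logE logD) _ _ => //.
by rewrite -(subrr HH); apply: eqmB.
Qed.

End Logarithm.

(** * The Laurent expansion of the wave *)

Section Transport.
Context (A A' : comNzRingType) (phi : {rmorphism A -> A'}).

Lemma eqm_map n (p q : {poly A}) :
  eqm n p q -> eqm n (map_poly phi p) (map_poly phi q).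
Proof. by move=> e i li; rewrite !coef_map e. Qed.

Lemma map_prod_inv (emb : {rmorphism rat -> A}) (emb' : {rmorphism rat -> A'})
    n B0 Bs :
  phi \o emb =1 emb' ->
  map_poly phi (prod_inv emb n B0 Bs) =
  prod_inv emb' n B0 [seq (phi yB.1, yB.2) | yB <- Bs].
Proof.
move=> e; have scX b : map_poly phi (b%:~R *: 'X) = b%:~R *: 'X.
  by rewrite map_polyZ map_polyX /= rmorph_int.
rewrite /prod_inv rmorphM !rmorph_prod big_map; congr (_ * _).
  apply: eq_bigr => b _; rewrite /= map_comp_poly scX; congr (_ \Po _).
  by apply/polyP=> i; rewrite coef_map !coef_poly /= (fun_if phi) -e rmorph0.
apply: eq_bigr => yB _; rewrite rmorph_prod; apply: eq_bigr => b _.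
rewrite /= map_comp_poly scX; congr (_ \Po _).
rewrite rmorphB rmorph1 /= map_polyZ rmorphB rmorph1; congr (_ - _ *: (_ - _)).
by apply/polyP=> i; rewrite coef_map !coef_poly /= (fun_if phi) -e rmorph0.
Qed.

End Transport.

Section Laurent.
Context (C : numClosedFieldType).
Implicit Types (u v : nat -> C) (p q : {poly C}).

Definition expands n u p := forall i, (i < n)%N -> u i = p`_i.

Lemma expands_mul n u v p q :
  expands n u p -> expands n v q -> expands n (fps_mul u v) (p * q).
Proof.
move=> e f i li; rewrite coefM; apply: eq_bigr => j _.
by rewrite e ?f //; apply: leq_ltn_trans li; rewrite ?leq_subr // -ltnS.
Qed.

(** The recursion of [fps_div_seq] solves q v = u coefficient by coefficient, so any polynomial
    solution modulo s^n gives the first n coefficients of the quotient. *)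
Lemma fps_div_expands n u v q :
  v 0%N != 0 -> expands n u (q * \poly_(i < n) v i) -> expands n (fps_div u v) q.
Proof.
move=> v0 e; have H k : (k <= n)%N -> fps_div_seq u v k = mkseq (nth 0 q) k.
  elim: k => [|k IH] // lk; rewrite /= (IH (ltnW lk)) mkseqS; congr rcons.
  rewrite (e k lk) coefM big_ord_recr /= subnn coef_poly (leq_trans _ lk) //.
  rewrite [X in X + _ - _](eq_bigr (fun i : 'I_k => (mkseq (nth 0 q) k)`_i * v (k - i)%N)).
    by rewrite addrC addKr mulfK.
  move=> i _; rewrite nth_mkseq // coef_poly (leq_trans _ lk) //.
  by rewrite ltnS leq_subr.
by move=> i li; rewrite /fps_div H // nth_mkseq.
Qed.

Lemma fps_orderE d v :
  (forall i, (i < d)%N -> v i = 0) -> v d != 0 -> fps_order v = d.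
Proof.
move=> v0 vd; rewrite /fps_order; case: pselect => [nz|[]]; last by exists d.
case: ex_minnP => m vm mmin; apply/eqP; rewrite eqn_leq mmin // leqNgt.
by apply/negP => /v0 e; rewrite e eqxx in vm.
Qed.

(** Since v has order d, the residue of u / v is the coefficient of s^(d-1) in u E / k. Knowing v
    modulo s^(2d) leaves d coefficients after division by s^d, as many as this coefficient
    involves. *)
Lemma residue_laurent_div d u v (k : C) (D E : {poly C}) :
  (0 < d)%N -> k != 0 -> D`_0 = 1 -> expands d.*2 v (k *: ('X^d * D)) ->
  eqm d (E * D) 1 ->
  residue0 (laurent_div u v) = k^-1 * \sum_(m < d) u m * E`_(d - 1 - m).
Proof.
move=> d0 k0 D0 ev eE.
have ed : fps_order v = d.
  apply: fps_orderE => [i li|].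
    rewrite ev ?coefZ ?coefXnM ?li ?mulr0 //.
    by rewrite -addnn (leq_trans li) ?leq_addr.
  rewrite ev ?coefZ ?coefXnM ?ltnn ?subnn ?D0 ?mulr1 //.
  by rewrite -addnn -[X in (X < _)%N]addn0 ltn_add2l.
rewrite /residue0 /laurent_div ed; case: d d0 ed ev eE => // d _ ed ev eE.
rewrite (_ : -1 + _ = Posz d); last by rewrite -add1n PoszD addrA addNr add0r.
rewrite (@fps_div_expands d.+1 _ _ (k^-1 *: (\poly_(i < d.+1) u i * E))) //.
- rewrite coefZ coefM; congr (_ * _); apply: eq_bigr => i _.
  by rewrite coef_poly ltn_ord subn1.
- by rewrite add0n ev ?coefZ ?coefXnM ?ltnn ?subnn ?D0 ?mulr1 // -addnn addnS ltnS leq_addr.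
move=> i li; have -> : u i = (\poly_(j < d.+1) u j * 1)`_i.
  by rewrite mulr1 coef_poly li.
apply: (@eqm_trans _ d.+1 (\poly_(j < d.+1) u j * (E * D))) li.
  by apply: eqmM => //; apply: eqm_sym.
rewrite mulrA -[_ * D]scale1r -(mulVf k0) -scalerA scalerAr scalerAl.
apply: eqmM => // j lj; rewrite coef_poly lj ev; last by rewrite -addnn ltn_add2r.
by rewrite !coefZ coefXnM ltnNge leq_addl addnK.
Qed.

Context (z : C) (f : nat).
Context (prim_z : f.-primitive_root z).

Lemma prim_root_dvd b : (f %| b)%N = (z ^+ b == 1).
Proof. exact: prim_order_dvd. Qed.

(** This equals z^b / (1 - z^b), the y for which 1 - z^b e^(bs) = (1 - z^b) (1 - y (e^(bs) - 1)). *)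
Definition recip_y b : C := (1 - z ^+ b)^-1 - 1.

(** The denominator of the wave is this constant times s^d times [wave_tail], whose constant term is
    1. A factor 1 - e^(bs) = - b s / g(bs) contributes - b, any other factor contributes 1 - z^b. *)
Definition wave_lead (a : seq nat) : C :=
  (-1) ^+ count (dvdn f) a * (\prod_(b <- a | (f %| b)%N) b%:R)
  * \prod_(b <- a | ~~ (f %| b)%N) (1 - z ^+ b).

Definition wave_tail n (a : seq nat) : {poly C} :=
  (\prod_(b <- a | (f %| b)%N) (g_inv (@ratr C) n \Po (b%:R *: 'X))) *
  \prod_(b <- a | ~~ (f %| b)%N) (gy_inv (@ratr C) n (recip_y b) \Po (b%:R *: 'X)).

Lemma ratr_invn n : ratr n%:R^-1 = n%:R^-1 :> C.
Proof. by rewrite fmorphV rmorph_nat. Qed.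

Lemma wave_factor_expands n b :
  expands n (wave_factor z b)
    (if (f %| b)%N then - b%:R *: ('X * (g_inv (@ratr C) n \Po (b%:R *: 'X)))
     else (1 - z ^+ b) *: (gy_inv (@ratr C) n (recip_y b) \Po (b%:R *: 'X))).
Proof.
move=> i li; rewrite /wave_factor /fps_exp prim_root_dvd.
have [zb|zb] := eqVneq (z ^+ b) 1.
  rewrite zb coefZ coefXM; case: i li => [|i] li.
    by rewrite expr0 fact0 mulr1n invr1 !mulr1 subrr mulr0.
  rewrite coef_comp_scaleX coef_poly (ltnW li) /= ratr_invn sub0r mul1r exprS.
  by rewrite mulNr mulrA.
have nz : 1 - z ^+ b != 0 by rewrite subr_eq0 eq_sym.
rewrite coefZ coef_comp_scaleX coefB coefZ coefB coef1 coef_poly li /= ratr_invn.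
rewrite /recip_y; case: i li => [|i] li /=.
  by rewrite fact0 expr0 mulr1n invr1 subrr mulr0 !mul1r subr0 !mulr1.
by rewrite !sub0r subr0; set F := _`!%:R^-1; field.
Qed.

Lemma wave_denom_expands n a :
  expands n (wave_denom z a)
    (wave_lead a *: ('X^(count (dvdn f) a) * wave_tail n a)).
Proof.
rewrite /wave_lead /wave_tail; elim: a => [|b a IH].
  by move=> i _; rewrite !big_nil !mulr1 expr0 scale1r coef1.
have := expands_mul (wave_factor_expands b) IH.
rewrite !big_cons /=; case: ifP => fb /= e i li; rewrite (e i li) -!mul_polyC;
  rewrite ?add1n ?add0n ?exprS ?polyCN ?polyCM; apply: (congr1 (fun p : {poly C} => p`_i)); ring.
Qed.

Lemma wave_tail0 n a : (0 < n)%N -> (wave_tail n a)`_0 = 1.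
Proof.
move=> n0; have coef0_prod (P : pred nat) (F : nat -> {poly C}) :
    (forall b, (F b)`_0 = 1) -> (\prod_(b <- a | P b) F b)`_0 = 1.
  by move=> F0; elim/big_ind: _ => [|p q p0 q0|//]; rewrite ?coef1 // coefM big_ord1 p0 q0 mulr1.
rewrite /wave_tail coefM big_ord1 !coef0_prod ?mulr1 // => b;
  rewrite coef_comp_scaleX mul1r.
  by rewrite coefB coefZ coefB coef1 coef_poly n0 /= ratr_invn fact0 mulr1n invr1 subrr mulr0 subr0.
by rewrite coef_poly n0 /= ratr_invn factS fact0 muln1 mulr1n invr1.
Qed.

Lemma wave_lead_neq0 a : all (fun b => 0 < b)%N a -> wave_lead a != 0.
Proof.
move=> /allP a0; rewrite /wave_lead !mulf_neq0 ?signr_eq0 //.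
  by rewrite prodf_seq_neq0; apply/allP => b /a0 b0; rewrite pnatr_eq0 -lt0n b0 implybT.
rewrite prodf_seq_neq0; apply/allP => b _; apply/implyP.
by rewrite prim_root_dvd subr_eq0 eq_sym.
Qed.

Lemma residue_wave a t (E : {poly C}) :
  let d := count (dvdn f) a in
  all (fun b => 0 < b)%N a -> (0 < d)%N ->
  eqm d (E * wave_tail d.*2 a) 1 ->
  residue0 (laurent_div (fun n => z ^- t * fps_exp (- t%:R) n) (wave_denom z a)) =
  (wave_lead a)^-1 *
    \sum_(m < d) z ^- t * ((- t%:R) ^+ m / m`!%:R) * E`_(d - 1 - m).
Proof.
move=> d a0 d0 eE; apply: residue_laurent_div eE => //.
- exact: wave_lead_neq0.
- by rewrite wave_tail0 // double_gt0.
exact: wave_denom_expands.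
Qed.

End Laurent.

(** * Roots of unity and evaluation in Q[x]/<Phi_f> *)

Section QuotientEvaluation.
Context (h : {poly rat}) (C : numClosedFieldType) (x : C).

(** The proof that x is a root of the modulus is an argument, so that the ring morphism structures
    resting on it can be declared as instances. The modulus of the quotient is [mk_monic h]. *)
Definition qpoly_eval (hx : root (map_poly ratr (mk_monic h)) x)
  (p : {poly %/ h}) : C := (map_poly ratr (val p)).[x].

Context (hx : root (map_poly ratr (mk_monic h)) x).

Lemma qpoly_eval_in p : qpoly_eval hx (in_qpoly h p) = (map_poly ratr p).[x].
Proof.
rewrite /qpoly_eval /= [in RHS](Pdiv.RingMonic.rdivp_eq (monic_mk_monic h) p).
by rewrite rmorphD rmorphM hornerD hornerM (rootP hx) mulr0 add0r.
Qed.

Fact qpoly_eval_zmod : zmod_morphism (qpoly_eval hx).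
Proof.
move=> p q; rewrite /qpoly_eval -[val (p - q)]/(val p - val q).
by rewrite rmorphB hornerD hornerN. Qed.

Fact qpoly_eval_monoid : monoid_morphism (qpoly_eval hx).
Proof.
split=> [|p q]; first by rewrite /qpoly_eval /= rmorph1 hornerC.
rewrite -[p * q]/(in_qpoly h (val p * val q)) qpoly_eval_in.
by rewrite rmorphM hornerM.
Qed.

HB.instance Definition _ :=
  GRing.isZmodMorphism.Build {poly %/ h} C (qpoly_eval hx) qpoly_eval_zmod.
HB.instance Definition _ :=
  GRing.isMonoidMorphism.Build {poly %/ h} C (qpoly_eval hx) qpoly_eval_monoid.

Lemma qpoly_evalC k : qpoly_eval hx (qpolyC h k) = ratr k.
Proof. by rewrite /qpoly_eval /= map_polyC hornerC. Qed.

End QuotientEvaluation.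

Section RootsOfUnity.
Context (C : numClosedFieldType).

Lemma prim_root_neq0 f (z : C) : f.-primitive_root z -> z != 0.
Proof.
by move=> pz; rewrite (prim_root_eq0 pz) -lt0n (prim_order_gt0 pz).
Qed.

Lemma root_prod (I : Type) (s : seq I) (F : I -> {poly C}) z :
  root (\prod_(i <- s) F i) z = has (fun i => root (F i) z) s.
Proof. by rewrite rootE horner_prod prodf_seq_eq0. Qed.

Lemma mem_prim_roots f (z : C) :
  (0 < f)%N -> (z \in prim_roots C f) = f.-primitive_root z.
Proof.
move=> f0; rewrite /prim_roots mem_filter mem_undup.
case: closed_field_poly_normal => r /= e; apply: andb_idr => pz.
have : root ('X^f - 1) z.
  by rewrite rootE !hornerE prim_expr_order // subrr.
by rewrite e (monicP _) ?monicXnsubC // scale1r root_prod_XsubC.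
Qed.

Lemma uniq_prim_roots f : uniq (prim_roots C f).
Proof. by rewrite filter_uniq // undup_uniq. Qed.

(** In characteristic 0 the polynomial X^f - 1 is separable, so it splits into distinct linear
    factors; its roots serve as interpolation nodes. *)
Lemma unity_roots f : (0 < f)%N ->
  exists r : seq C, [/\ uniq r, size r = f & all f.-unity_root r].
Proof.
move=> f0; have [r e] := closed_field_poly_normal ('X^f - 1 : {poly C}).
rewrite (monicP _) ?monicXnsubC // scale1r in e; exists r; split.
- by rewrite -separable_prod_XsubC -e separable_Xn_sub_1 // pnatr_eq0 -lt0n.
- by apply: succn_inj; rewrite -(size_prod_XsubC r id) -e size_XnsubC.
by apply/allP=> z; rewrite -root_prod_XsubC -e.
Qed.

Lemma sum_unity_root f (x : C) : x ^+ f = 1 ->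
  \sum_(j < f) x ^+ j = if x == 1 then f%:R else 0.
Proof.
move=> xf; case: eqP => [->|/eqP x1].
  by under eq_bigr do rewrite expr1n; rewrite sumr_const card_ord.
have x0 : x - 1 != 0 by rewrite subr_eq0.
by apply: (mulfI x0); rewrite -subrX1 xf subrr mulr0.
Qed.

(** Inverse discrete Fourier transform: a polynomial of degree below f is determined by its values
    at the f-th roots of unity. *)
Lemma coef_from_unity_values f (q : {poly C}) (G : C -> C) j :
  (0 < f)%N -> (size q <= f)%N ->
  (forall w, w ^+ f = 1 ->
     q.[w] = if f.-primitive_root w then G w * f%:R / w else 0) ->
  (j < f)%N -> q`_j = \sum_(z <- prim_roots C f) G z * z ^- j.+1.
Proof.
move=> f0 sq qw lj.
(* The interpolant: at an f-th root of unity w the inner polynomial is z^-1 times a geometric sum in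
   w / z, which is f / z if w = z and 0 otherwise. *)
pose p := \sum_(z <- prim_roots C f) G z *: \poly_(i < f) z ^- i.+1.
suff -> : q = p.
  rewrite coef_sum; apply: eq_bigr => z _.
  by rewrite coefZ coef_poly lj.
apply/eqP; rewrite -subr_eq0; apply/negPn/negP => nz.
have [r [ur sr /allP rr]] := unity_roots f0.
have sqp : (size (q - p)%R <= f)%N.
  rewrite (leq_trans (size_polyD _ _)) // geq_max sq size_polyN.
  rewrite (leq_trans (size_sum _ _ _)) //; apply/bigmax_leqP_seq => z _ _.
  by rewrite (leq_trans (size_scale_leq _ _)) // size_poly.
(* A nonzero difference of size at most f cannot vanish at f distinct points. *)
suff /(max_poly_roots nz) /(_ ur) : all (root (q - p)) r by rewrite sr ltnNge sqp.
apply/allP => w /rr; rewrite unity_rootE => /eqP wf.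
have w0 : w != 0.
  by apply: contra_eq_neq wf => ->; rewrite expr0n gtn_eqF // eq_sym oner_eq0.
rewrite rootE hornerD hornerN subr_eq0 qw // horner_sum; apply/eqP.
rewrite (eq_big_seq (fun z => if z == w then G w * f%:R / w else 0)); last first.
  move=> z; rewrite mem_prim_roots // => pz.
  have z0 : z != 0 := prim_root_neq0 pz.
  rewrite hornerZ horner_poly.
  under eq_bigr => i _ do rewrite exprS invfM -mulrA -exprVn -exprMn.
  rewrite -mulr_sumr sum_unity_root; last first.
    by rewrite exprMn exprVn (prim_expr_order pz) wf invr1 mulr1.
  have -> : (z^-1 * w == 1) = (z == w).
    by rewrite -(inj_eq (mulfI z0)) mulVKf // mulr1 eq_sym.
  by case: eqP => [->|_]; rewrite ?mulr0 // mulrA mulrAC.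
case: ifP => pw; last first.
  rewrite big_seq big1 // => z; rewrite mem_prim_roots //.
  by case: eqP => // ->; rewrite pw.
rewrite -big_mkcond -big_filter (perm_big [:: w]) ?big_seq1 //.
apply: uniq_perm => [||z] //; first exact/filter_uniq/uniq_prim_roots.
rewrite mem_filter inE; case: eqP => // ->.
by rewrite mem_prim_roots.
Qed.

Definition cycloC n : {poly C} := map_poly intr 'Phi_n.

Lemma map_cyclo n : map_poly ratr (cyclo n) = cycloC n.
Proof.
by rewrite /cyclo -map_poly_comp; apply: eq_map_poly => k; rewrite /= ratr_int.
Qed.

Lemma prod_cycloC n : (0 < n)%N -> \prod_(d <- divisors n) cycloC d = 'X^n - 1.
Proof.
move=> n0; rewrite -rmorph_prod prod_Cyclotomic // rmorphB rmorph1 /=.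
by rewrite map_polyXn.
Qed.

(** As a root of X^n - 1, z is a root of Phi_d for some d dividing n. Then z^d = 1, so n divides d
    and d = n. *)
Lemma root_cycloC n (z : C) : n.-primitive_root z -> root (cycloC n) z.
Proof.
move=> pz; have n0 := prim_order_gt0 pz.
have : root (\prod_(d <- divisors n) cycloC d) z.
  by rewrite prod_cycloC // rootE !hornerE prim_expr_order // subrr.
rewrite root_prod => /hasP[d]; rewrite -dvdn_divisors // => dn rd.
suff : (n %| d)%N by move=> nd; have /eqP -> : n == d by rewrite eqn_dvd nd dn.
have d0 : (0 < d)%N by apply: dvdn_gt0 dn.
rewrite (prim_order_dvd pz) -subr_eq0.
have : root ('X^d - 1) z.
  rewrite -prod_cycloC // root_prod; apply/hasP; exists d => //.
  by rewrite -dvdn_divisors.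
by rewrite rootE !hornerE.
Qed.

End RootsOfUnity.

Lemma cyclo_monic f : cyclo f \is monic.
Proof. exact/monic_map/Cyclotomic_monic. Qed.

(** [mk_monic] replaces a modulus that is constant or not monic by a default one; for f > 0 the
    quotient is indeed by Phi_f. *)
Lemma mk_monic_cyclo f : (0 < f)%N -> mk_monic (cyclo f) = cyclo f.
Proof.
move=> f0; rewrite /mk_monic cyclo_monic andbT size_map_poly_id0.
  by rewrite size_Cyclotomic ltnS totient_gt0 f0.
by rewrite (monicP (Cyclotomic_monic f)) oner_eq0.
Qed.

Lemma mk_monic_Xn_sub_1 f :
  (0 < f)%N -> mk_monic ('X^f - 1 : {poly rat}) = 'X^f - 1.
Proof.
by move=> f0; rewrite /mk_monic monicXnsubC // size_XnsubC // ltnS f0.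
Qed.

Lemma cyclo_hatE f : (0 < f)%N ->
  cyclo_hat f = \prod_(d <- rem f (divisors f)) cyclo d.
Proof.
move=> f0; rewrite /cyclo_hat.
have -> : 'X^f - 1 = map_poly intr ('X^f - 1 : {poly int}) :> {poly rat}.
  by rewrite rmorphB rmorph1 /= map_polyXn.
rewrite -prod_Cyclotomic // (big_rem f) -?dvdn_divisors //= rmorphM mulKp.
  by rewrite rmorph_prod.
exact/monic_neq0/cyclo_monic.
Qed.

Lemma cyclo_hatM f : (0 < f)%N -> cyclo f * cyclo_hat f = 'X^f - 1.
Proof.
move=> f0; have -> : 'X^f - 1 = map_poly intr ('X^f - 1 : {poly int}) :> {poly rat}.
  by rewrite rmorphB rmorph1 /= map_polyXn.
rewrite -prod_Cyclotomic // (big_rem f) -?dvdn_divisors //=.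
by rewrite rmorphM rmorph_prod cyclo_hatE.
Qed.

(** * Values of the cyclotomic factors at roots of unity *)

Section CycloValues.
Context (C : numClosedFieldType) (f : nat).
Context (f0 : (0 < f)%N).

(** The order d of w is a proper divisor of f, and Phi_d is one of the factors of [cyclo_hat f]. *)
Lemma cyclo_hat_root (w : C) : w ^+ f = 1 -> ~~ f.-primitive_root w ->
  (map_poly ratr (cyclo_hat f)).[w] = 0.
Proof.
move=> wf npw; have [d pd dn] := prim_order_exists f0 wf.
apply/rootP; rewrite cyclo_hatE // rmorph_prod root_prod; apply/hasP.
exists d; last by rewrite /= map_cyclo; apply: root_cycloC.
rewrite mem_rem_uniq ?divisors_uniq // inE -dvdn_divisors // dn andbT.
by apply: contraNneq npw => <-.
Qed.

(** Differentiate Phi_f times its cofactor, equal to X^f - 1, at z: the term with Phi_f(z) vanishes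
    and f z^(f-1) = f / z. *)
Lemma cyclo_hat_deriv (z : C) : f.-primitive_root z ->
  (map_poly ratr (cyclo_hat f)).[z] * (map_poly ratr (cyclo f)^`()).[z] = f%:R / z.
Proof.
move=> pz; have z0 := prim_root_neq0 pz.
have := congr1 (fun p => (map_poly ratr p^`()).[z] : C) (cyclo_hatM f0).
rewrite derivM derivB derivXn derivC subr0 rmorphD !rmorphM hornerD !hornerM /=.
rewrite map_cyclo (rootP (root_cycloC pz)) mul0r addr0 mulrC => ->.
rewrite rmorphMn /= map_polyXn hornerMn hornerXn.
apply: (mulIf z0); rewrite mulfVK // mulrnAl -exprSr prednK //.
by rewrite prim_expr_order.
Qed.

(** Differentiate (X - 1) theta = X^f - 1 at x, where theta vanishes. With x = z^(a_i) this shows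
    that v_i is the inverse of 1 - z^(a_i). *)
Lemma theta_deriv (x : C) : x ^+ f = 1 -> x != 1 ->
  - f%:R^-1 * (x * (map_poly ratr (theta f)^`()).[x]) = (1 - x)^-1.
Proof.
move=> xf x1; have x0 : 1 - x != 0 by rewrite subr_eq0 eq_sym.
have thE : theta f = \sum_(i < f) 'X^i :> {poly rat}.
  by rewrite /theta poly_def; apply: eq_bigr => i _; rewrite scale1r.
have e : ('X - 1) * theta f = 'X^f - 1 by rewrite thE -subrX1.
have th0 : (map_poly ratr (theta f)).[x] = 0.
  rewrite thE rmorph_sum horner_sum.
  under eq_bigr do rewrite /= map_polyXn hornerXn.
  by rewrite sum_unity_root // (negPf x1).
have := congr1 (fun p => (map_poly ratr p^`()).[x] : C) e.
rewrite derivM !derivB derivX derivC subr0 mul1r derivXn rmorphD rmorphM rmorphB.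
rewrite rmorph1 /= map_polyX !hornerE th0 add0r subr0 rmorphMn /= map_polyXn hornerMn hornerXn.
set t := (map_poly _ _).[x] => et.
have {}et : (1 - x) * (x * t) = - f%:R.
  have -> : (1 - x) * (x * t) = - (x * ((x - 1) * t)) by ring.
  by rewrite et mulrnAr -exprS prednK // xf.
have f1 : f%:R != 0 :> C by rewrite pnatr_eq0 -lt0n.
apply: (mulfI x0); rewrite mulfV // [LHS](_ : _ = - f%:R^-1 * ((1 - x) * (x * t))); last first.
  by set F := f%:R^-1; ring.
by rewrite et mulNr mulrN opprK mulVf.
Qed.

End CycloValues.

Lemma fst_mapC (S T : Type) (F : S -> Defs.comp T) s :
  (mapC F s).1 = [seq (F x).1 | x <- s].
Proof. by elim: s => //= x s ->. Qed.

Lemma fst_prodC (A : comNzRingType) (s : seq A) : (prodC s).1 = \prod_(x <- s) x.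
Proof.
rewrite /prodC fst_foldC; suff H y : foldl (fun z x : A => x * z) y s = y * \prod_(x <- s) x.
  by rewrite H mul1r.
elim: s y => [|x s IH] y /=; first by rewrite big_nil mulr1.
by rewrite IH big_cons mulrA [x * y]mulrC.
Qed.

Lemma fst_signC n x : (signC n x).1 = (-1) ^+ n * x.
Proof.
by rewrite /signC -signr_odd; case: odd; rewrite /= ?expr1 ?expr0 ?mul1r ?mulN1r.
Qed.

(* Every embedding emb of Q in A is compatible with ratr, so the morphism phi
   alone carries the output of the log-exponential method into C. *)
Lemma map_log_exp (A : comNzRingType) (emb : {rmorphism rat -> A}) c
    (mul : fft_mul A c) (C : numClosedFieldType) (phi : {rmorphism A -> C}) d n B0 Bs :
  (d <= n)%N ->
  eqm d (map_poly phi (log_exp emb mul d 0 B0 Bs).1 *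
         prod_inv (@ratr C) n B0 [seq (phi yB.1, yB.2) | yB <- Bs]) 1.
Proof.
move=> ledn; have := @log_exp_correct _ emb _ mul _ _ B0 Bs ledn.
set E := (log_exp _ _ _ _ _ _).1 => e; have := eqm_map phi e.
rewrite rmorphM rmorph1 /= (@map_prod_inv _ _ phi emb ratr) //.
exact: (fmorph_eq_rat (phi \o emb)).
Qed.

(** * Correctness of the algorithm *)

Section Correctness.
Context (c : nat) (a : seq nat).
Context (a_gt0 : all (fun b => 0 < b)%N a).

Lemma prim_roots1 (C : numClosedFieldType) : prim_roots C 1 = [:: 1].
Proof.
apply/perm_small_eq; rewrite //; apply: uniq_perm => [||z] //.
  exact: uniq_prim_roots.
rewrite mem_prim_roots // inE; apply/idP/eqP => [/prim_expr_order|->].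
  by rewrite expr1.
have [m pm] := prim_order_exists (ltn0Sn 0) (expr1 (1 : C)).
by rewrite dvdn1 => /eqP e; rewrite e in pm.
Qed.

(** The residues at the individual roots are added and the sums exchanged. The sign collects (-1)^d
    from [wave_lead], (-1)^m from the power of - t, and the overall minus of the wave. *)
Lemma wave_sum (C : numClosedFieldType) f t (E : C -> {poly C}) :
  let d := count (dvdn f) a in
  (0 < f)%N -> (0 < d)%N ->
  (forall z, f.-primitive_root z -> eqm d (E z * wave_tail z f d.*2 a) 1) ->
  sylvester_wave C f a t =
    \sum_(m < d) (-1) ^+ (d + m + 1) * m`!%:R^-1 *
      (\prod_(b <- a | (f %| b)%N) b%:R)^-1 * t%:R ^+ m *
      \sum_(z <- prim_roots C f) (E z)`_(d - 1 - m) *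
         (\prod_(b <- a | ~~ (f %| b)%N) (1 - z ^+ b)^-1) * z ^- t.
Proof.
move=> d f0 d0 eE.
have -> : sylvester_wave C f a t = - \sum_(z <- prim_roots C f) (wave_lead z f a)^-1 *
    \sum_(m < d) z ^- t * ((- t%:R) ^+ m / m`!%:R) * (E z)`_(d - 1 - m).
  rewrite /sylvester_wave /residue0; congr (- _); apply: eq_big_seq => z.
  rewrite mem_prim_roots // => pz.
  exact: (residue_wave pz t a_gt0 d0 (eE z pz)).
under [X in - X = _]eq_bigr do rewrite mulr_sumr.
rewrite exchange_big /= -sumrN; apply: eq_bigr => m _.
rewrite mulr_sumr -sumrN; apply: eq_bigr => z _.
rewrite /wave_lead !invfM -/d prodfV invr_sign [(- t%:R) ^+ _]exprNn !exprD expr1.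
by ring.
Qed.

(** Each entry not divisible by f lies in exactly one of the listed residue classes and the
    multiples of f lie in none; z^b depends only on the class of b. *)
Lemma prod_inv_wave_tail (C : numClosedFieldType) (z : C) f n :
  f.-primitive_root z ->
  prod_inv (@ratr C) n [seq b%:Z | b <- multiples f a]
    [seq (recip_y z r, [seq b%:Z | b <- a & (b %% f == r)%N])
       | r <- undup [seq b %% f | b <- nonmultiples f a]%N] =
  wave_tail z f n a.
Proof.
move=> pz; rewrite /prod_inv /wave_tail !big_map big_filter; congr (_ * _).
pose F r b := gy_inv (@ratr C) n (recip_y z r) \Po (b%:R *: 'X).
rewrite (eq_bigr (fun r => \prod_(b <- a | (b %% f == r)%N) F r b)); last first.
  by move=> r _; rewrite /= big_map big_filter.
rewrite (exchange_big_dep predT) //= [RHS]big_mkcond /=.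
apply: eq_big_seq => b ba; case: ifPn => [fb|fb]; last first.
  rewrite big_seq_cond big1 // => r /andP[rin /eqP br]; exfalso.
  move: rin; rewrite mem_undup => /mapP[b']; rewrite mem_filter => /andP[nb' _] e.
  by move: nb'; rewrite /dvdn -e -br -/(dvdn f b) (negPn fb).
have rin : (b %% f)%N \in undup [seq b %% f | b <- nonmultiples f a]%N.
  by rewrite mem_undup; apply/mapP; exists b; rewrite // mem_filter fb.
rewrite -big_filter (perm_big [:: (b %% f)%N]).
  by rewrite big_seq1 /F /recip_y (prim_expr_mod pz).
apply: uniq_perm => [||r] //; first exact/filter_uniq/undup_uniq.
by rewrite mem_filter inE eq_sym; case: eqP => // ->.
Qed.

Lemma cyc_denum1_correct (mul : fft_mul rat c) :
  (0 < size a)%N -> computes_wave 1 a (cyc_denum1 mul a).1.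
Proof.
move=> a0; pose N := size a; split=> // C t i li _; have -> : i = 1%N.
  by move: li; rewrite -eqn_leq => /eqP.
pose L := (log_exp idfun mul N 0 [seq b%:Z | b <- a] [::]).1.
pose p := (prodC [seq b%:R : rat | b <- a]).1.
change (sylvester_wave C 1 a t = ratr (\poly_(m < N)
  ((signC (N + m + 1) ((inv_facts idfun N).1`_m * p^-1)).1 * L`_(N - 1 - m))).[t%:R]).
have countE : count (dvdn 1) a = N.
  by apply/eqP; rewrite -all_count; apply/allP => b _; rewrite dvd1n.
have nil1 : nonmultiples 1 a = [::].
  by apply/eqP; rewrite -[_ == _]negbK -has_filter has_predC negbK; apply/allP => b _; exact: dvd1n.
have mul1 : multiples 1 a = a by apply/all_filterP/allP => b _; exact: dvd1n.
rewrite (@wave_sum C 1 t (fun=> map_poly ratr L)) ?countE //; last first.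
  move=> z pz; have := @map_log_exp _ idfun _ mul C ratr N N.*2 [seq b%:Z | b <- a] [::].
  rewrite -/L -(prod_inv_wave_tail _ pz) nil1 mul1; apply.
  by rewrite -addnn leq_addr.
rewrite horner_poly rmorph_sum; apply: eq_bigr => m _.
rewrite prim_roots1 big_seq1 expr1n invr1 mulr1.
rewrite [\prod_(b <- a | ~~ _) _]big_pred0 ?mulr1; last first.
  by move=> b; rewrite dvd1n.
rewrite coef_map fst_signC nth_inv_facts // /p fst_prodC big_map.
rewrite (eq_bigl predT) => [|b]; last by rewrite dvd1n.
rewrite /= !rmorphM !fmorphV !rmorphXn /= rmorphN1 !rmorph_nat.
have -> : ratr (\prod_(b <- a) b%:R : rat) = \prod_(b <- a) b%:R :> C.
  by rewrite rmorph_prod; apply: eq_bigr => b _; rewrite rmorph_nat.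
by ring.
Qed.

(** * The case f > 1 *)

Context (f : nat) (f_gt1 : (1 < f)%N).

Let f_gt0 : (0 < f)%N := ltnW f_gt1.

Lemma cyclo_mod_root (C : numClosedFieldType) (z : C) :
  f.-primitive_root z -> root (map_poly ratr (mk_monic (cyclo f))) z.
Proof.
by move=> pz; rewrite mk_monic_cyclo // map_cyclo; apply: root_cycloC.
Qed.

Definition residues := undup [seq b %% f | b <- nonmultiples f a]%N.

Definition v_elt (r : nat) : ringR f :=
  (reduceR f (- (f%:R)^-1 *: ('X^r * ((theta f)^`() \Po 'X^r)))).1.

Definition Mhat (mul : fft_mul (ringR f) c) : {poly ringR f} :=
  let d := size (multiples f a) in
  (log_exp (embR f) mul d 0 [seq b%:Z | b <- multiples f a]
    (zip [seq v_elt r - 1 | r <- residues]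
         [seq [seq b%:Z | b <- a & (b %% f == r)%N] | r <- residues])).1.

Lemma qpoly_eval_v_elt (C : numClosedFieldType) (z : C)
    (hz : root (map_poly ratr (mk_monic (cyclo f))) z) r :
  f.-primitive_root z -> ~~ (f %| r)%N -> qpoly_eval hz (v_elt r) = (1 - z ^+ r)^-1.
Proof.
move=> pz fr; rewrite /v_elt /= qpoly_eval_in map_polyZ rmorphM /= map_polyXn.
rewrite map_comp_poly /= map_polyXn hornerZ hornerM horner_comp !hornerXn.
rewrite rmorphN fmorphV rmorph_nat theta_deriv // -?(prim_root_dvd pz) //.
by rewrite exprAC (prim_expr_order pz) expr1n.
Qed.

Lemma mem_residues r : r \in residues -> ~~ (f %| r)%N.
Proof.
rewrite mem_undup => /mapP[b]; rewrite mem_filter => /andP[fb _] ->.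
by rewrite /dvdn modn_mod.
Qed.

Lemma Mhat_correct mul (C : numClosedFieldType) (z : C)
    (hz : root (map_poly ratr (mk_monic (cyclo f))) z) :
  let d := count (dvdn f) a in
  f.-primitive_root z ->
  eqm d (map_poly (qpoly_eval hz) (Mhat mul) * wave_tail z f d.*2 a) 1.
Proof.
move=> d pz; rewrite -prod_inv_wave_tail // /Mhat size_filter -/d.
have le : (d <= d.*2)%N by rewrite -addnn leq_addr.
have := @map_log_exp _ (embR f) _ mul C (qpoly_eval hz) d d.*2
  [seq b%:Z | b <- multiples f a]
  (zip [seq v_elt r - 1 | r <- residues]
       [seq [seq b%:Z | b <- a & (b %% f == r)%N] | r <- residues]) le.
rewrite zip_map -map_comp; congr (eqm d (_ * prod_inv _ _ _ _) _).
apply/eq_in_map => r /mem_residues fr /=; congr (_, _).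
by rewrite rmorphB rmorph1 /= qpoly_eval_v_elt.
Qed.

Lemma cyc_denum_R_value mul (C : numClosedFieldType) (z : C)
    (hz : root (map_poly ratr (mk_monic (cyclo f))) z) m :
  let d := count (dvdn f) a in
  f.-primitive_root z -> (m < d)%N ->
  qpoly_eval hz (cyc_denum_R mul a).1`_m =
  (map_poly (qpoly_eval hz) (Mhat mul))`_(d - 1 - m) *
  \prod_(b <- a | ~~ (f %| b)%N) (1 - z ^+ b)^-1.
Proof.
move=> d pz md; pose d' := size (multiples f a).
have dd : d' = d by rewrite /d' size_filter.
pose v := (mapC (fun r => reduceR f
          (- (f%:R)^-1 *: ('X^r * ((theta f)^`() \Po 'X^r)))) residues).1.
pose y := (mapC (fun w => Defs.subC w 1) v).1.
pose Mh := (log_exp (embR f) mul d' 0 [seq b%:Z | b <- multiples f a]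
             (zip y [seq [seq b%:Z | b <- a & (b %% f == r)%N] | r <- residues])).1.
pose pv := (prodC [seq v`_(index (b %% f)%N residues) | b <- nonmultiples f a]).1.
have -> : (cyc_denum_R mul a).1 =
  (mapC (fun m => Defs.mulC Mh`_(d' - 1 - m) pv) (iota 0 d')).1 by [].
have vE : v = [seq v_elt r | r <- residues] by rewrite /v fst_mapC.
have yE : y = [seq v_elt r - 1 | r <- residues] by rewrite /y fst_mapC vE -map_comp.
have MhE : Mh = Mhat mul by rewrite /Mh yE.
rewrite fst_mapC (nth_map 0%N) ?size_iota ?dd // nth_iota // add0n.
rewrite -[(Defs.mulC _ _).1]/(_ * _) rmorphM /= coef_map MhE; congr (_ * _).
rewrite /pv fst_prodC big_map rmorph_prod big_filter big_seq_cond [RHS]big_seq_cond.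
apply: eq_bigr => b /andP[ba fb].
have rin : (b %% f)%N \in residues.
  by rewrite mem_undup; apply/mapP; exists b; rewrite // mem_filter fb.
rewrite vE (nth_map 0%N) ?index_mem // nth_index //= qpoly_eval_v_elt ?(mem_residues rin) //.
by rewrite (prim_expr_mod pz).
Qed.

Definition wave_scalar m : rat :=
  (-1) ^+ (count (dvdn f) a + m + 1) * (m`!%:R^-1 * (\prod_(b <- multiples f a) b%:R)^-1).

Definition Q_elt (M : seq (ringR f)) m : ringS f :=
  embS f (wave_scalar m) * (in_qpoly ('X^f - 1) (repR M`_m) *
    (in_qpoly ('X^f - 1) (cyclo_hat f) * in_qpoly ('X^f - 1) (cyclo f)^`())).

Lemma cyc_denum_SE (M : seq (ringR f)) :
  (cyc_denum_S a M).1 =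
  mkseq (fun i => \poly_(m < count (dvdn f) a) (repS (Q_elt M m))`_i) f.
Proof.
pose d := size (multiples f a).
have dd : d = count (dvdn f) a by rewrite /d size_filter.
pose p := (prodC [seq b%:R : rat | b <- multiples f a]).1.
pose Q := (mapC (fun m =>
   Mm <-- reduceS f (repR M`_m) ;;
   cm <-- Defs.mulC Mm ((reduceS f (cyclo_hat f)).1 * (reduceS f (cyclo f)^`()).1) ;;
   x <-- Defs.mulC (inv_facts idfun d).1`_m p^-1 ;;
   s <-- signC (d + m + 1) x ;;
   Defs.mulC (embS f s) cm) (iota 0 d)).1.
have -> : (cyc_denum_S a M).1 = mkseq (fun i => \poly_(m < d) (repS Q`_m)`_i) f by [].
apply: eq_mkseq => i; rewrite -dd; apply: eq_poly => m md; congr ((repS _)`_i).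
rewrite /Q fst_mapC (nth_map 0%N) ?size_iota // nth_iota // add0n.
have pE : p = \prod_(b <- multiples f a) b%:R by rewrite /p fst_prodC big_map.
by rewrite /Q_elt /wave_scalar -pE -fst_signC -dd -(nth_inv_facts idfun md : _ = m`!%:R^-1).
Qed.

(** The element of S is evaluated at every f-th root of unity and its coefficients are recovered by
    [coef_from_unity_values]. The factor f / z from [cyclo_hat_deriv] accounts for the exponent j +
    1 instead of j. *)
Lemma repS_coef mul (C : numClosedFieldType) m j : 
  let d := count (dvdn f) a in
  let E z := map_poly (fun x : ringR f => (map_poly ratr (repR x)).[z] : C) (Mhat mul) in
  (m < d)%N -> (j < f)%N ->
  ratr (repS (Q_elt (cyc_denum_R mul a).1 m))`_j =
  ratr (wave_scalar m) * \sum_(z <- prim_roots C f) (E z)`_(d - 1 - m) *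
     (\prod_(b <- a | ~~ (f %| b)%N) (1 - z ^+ b)^-1) * z ^- j.+1.
Proof.
move=> d E md jf; rewrite -coef_map; set M := (cyc_denum_R mul a).1.
set V := fun z : C => \prod_(b <- a | ~~ (f %| b)%N) (1 - z ^+ b)^-1.
rewrite (coef_from_unity_values (f := f)
  (G := fun z => ratr (wave_scalar m) * ((E z)`_(d - 1 - m) * V z))) //.
- by rewrite mulr_sumr; apply: eq_bigr => z _; rewrite !mulrA.
- rewrite size_map_poly -ltnS -(size_XnsubC (1 : rat) f_gt0) -mk_monic_Xn_sub_1 //.
  exact: size_mk_monic.
move=> w wf.
have hw : root (map_poly ratr (mk_monic ('X^f - 1))) w.
  rewrite mk_monic_Xn_sub_1 // rmorphB rmorph1 /= map_polyXn rootE !hornerE.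
  by rewrite wf subrr.
rewrite -[LHS]/(qpoly_eval hw (Q_elt M m)) /Q_elt.
move: (wave_scalar m) => s; rewrite !rmorphM /= qpoly_evalC !qpoly_eval_in.
(* The standard form of M_m has a controlled value only at primitive roots; at the others the factor
   [cyclo_hat f] vanishes. *)
case: ifPn => pw; last by rewrite cyclo_hat_root // mul0r !mulr0.
rewrite cyclo_hat_deriv // -[(map_poly _ _).[w]]/(qpoly_eval (cyclo_mod_root pw) M`_m).
by rewrite cyc_denum_R_value // !mulrA.
Qed.

Lemma cyc_denum_correct (mul : fft_mul (ringR f) c) :
  has (dvdn f) a -> computes_wave f a (output (cyc_denum mul a)).
Proof.
rewrite has_count => d0; rewrite -[output _]/(cyc_denum_S a (cyc_denum_R mul a).1).1.
rewrite cyc_denum_SE; split; first by rewrite size_mkseq.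
move=> C t i /andP[i0 lif] ti.
pose E z := map_poly (fun x : ringR f => (map_poly ratr (repR x)).[z] : C) (Mhat mul).
have jf : (i.-1 < f)%N by rewrite prednK.
rewrite (wave_sum t (E := E)) // => [|z pz]; last first.
  exact: (Mhat_correct mul (cyclo_mod_root pz) pz).
rewrite nth_mkseq // horner_poly rmorph_sum; apply: eq_bigr => m _.
rewrite /= rmorphM /= repS_coef // prednK // rmorphXn rmorph_nat mulrAC.
congr (_ * _ * _); last first.
  (* Here z^t depends only on t modulo f, so t may be replaced by i. *)
  apply: eq_big_seq => z; rewrite mem_prim_roots // => pz; congr (_ / _).
  by rewrite -(prim_expr_mod pz t) ti prim_expr_mod.
rewrite /wave_scalar !rmorphM !fmorphV rmorphXn rmorphN1 rmorph_nat rmorph_prod.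
rewrite big_filter mulrA; congr (_ / _).
by apply: eq_bigr => b _; rewrite rmorph_nat.
Qed.

End Correctness.

(** * Operation counts *)

Local Close Scope ring_scope.

Lemma snd_foldC_leq (S : eqType) (T : Type) (F : S -> T -> Defs.comp T)
    (g : S -> nat) s x :
  (forall y z, y \in s -> (F y z).2 <= g y) -> (foldC F s x).2 <= \sum_(y <- s) g y.
Proof.
elim: s x => [|y s IH] x e; first by rewrite big_nil.
rewrite big_cons leq_add ?e ?mem_head // IH // => y' z ys; apply: e.
by rewrite inE ys orbT.
Qed.

Lemma snd_mapC_leq (S : eqType) (T : Type) (F : S -> Defs.comp T) n s :
  (forall y, (F y).2 <= n) -> (mapC F s).2 <= n * size s.
Proof.
move=> e; elim: s => [|y s IH]; first by rewrite muln0.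
by rewrite /= addn0 mulnS leq_add.
Qed.

Lemma snd_prodC_leq (A : comNzRingType) (s : seq A) : (prodC s).2 <= size s.
Proof.
by rewrite /prodC -sum1_size; apply: snd_foldC_leq.
Qed.

Lemma snd_tabC_leq (A : comNzRingType) n m (F : nat -> Defs.comp A) :
  (forall i, (F i).2 <= m) -> (tabC n F).2 <= m * n.
Proof.
move=> e; rewrite /= mulnC -[X in _ <= X * _]card_ord -sum_nat_const.
exact: leq_sum.
Qed.

Lemma snd_signC_leq n x : (signC n x).2 <= 1.
Proof. by rewrite /signC; case: odd. Qed.

Lemma lg_gt0 n : 0 < lg n.
Proof. by rewrite leq_max. Qed.

Lemma lg_expn k : lg (2 ^ k) = maxn 1 k.
Proof. by rewrite /lg up_expnK. Qed.

Lemma leq_lg m n : m <= n -> lg m <= lg n.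
Proof. by move=> le; rewrite geq_max leq_maxl leq_max leq_up_log ?orbT. Qed.

(** * Cost of power series arithmetic *)

Section SeriesCost.
Context (A : comNzRingType) (emb : {rmorphism rat -> A}).
Context (c : nat) (mul : fft_mul A c).

Definition nlg k := 2 ^ k * lg (2 ^ k).

Lemma leq_expn_nlg k : 2 ^ k <= nlg k.
Proof. by rewrite leq_pmulr ?lg_gt0. Qed.

(** Doubling the length at least doubles n log n, so in a Newton iteration all earlier rounds
    together cost no more than the last one. *)
Lemma nlg_double k : 2 * nlg k <= nlg k.+1.
Proof. by rewrite /nlg expnS -mulnA !leq_mul // leq_lg // leq_pmull. Qed.

Lemma fmul_nlg k p q : (mul (2 ^ k) p q).2 <= c * nlg k.
Proof. by apply: fmul_cost; rewrite expn_gt0. Qed.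

Lemma addS_cost n (p q : {poly A}) : (addS n p q).2 <= n.
Proof. by rewrite -[leqRHS]mul1n; apply: snd_tabC_leq. Qed.

Lemma subS_cost n (p q : {poly A}) : (subS n p q).2 <= n.
Proof. by rewrite -[leqRHS]mul1n; apply: snd_tabC_leq. Qed.

Lemma oppS_cost n (p : {poly A}) : (oppS n p).2 <= n.
Proof. by rewrite -[leqRHS]mul1n; apply: snd_tabC_leq. Qed.

Lemma hadamardS_cost n (p q : {poly A}) : (hadamardS n p q).2 <= n.
Proof. by rewrite -[leqRHS]mul1n; apply: snd_tabC_leq. Qed.

Lemma derivS_cost n (p : {poly A}) : (derivS n p).2 <= n.
Proof. by rewrite -[leqRHS]mul1n; apply: snd_tabC_leq. Qed.

Lemma integS_cost n (p : {poly A}) : (integS emb n p).2 <= n.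
Proof. by rewrite -[leqRHS]mul1n; apply: snd_tabC_leq => -[]. Qed.

Lemma inv_facts_cost n : (inv_facts emb n).2 <= n.
Proof.
case: n => // n; elim: n => [|n IH] //.
have -> : (inv_facts emb n.+2).2 = (inv_facts emb n.+1).2 + (1 + 0) by [].
by rewrite addn0 addn1 ltnS.
Qed.

Lemma invS_cost k p : (invS mul k p).2 <= (4 * c + 2) * nlg k.
Proof.
elim: k => [|k IH] //; set n := 2 ^ k.+1.
pose g := (invS mul k p).1; pose e := (mul n p g).1; pose e' := (subS n 2%:R e).1.
have -> : (invS mul k.+1 p).2 =
  (invS mul k p).2 + ((mul n p g).2 + ((subS n 2%:R e).2 + (mul n g e').2)) by [].
have := fmul_nlg k.+1 p g; have := fmul_nlg k.+1 g e'; have := subS_cost n 2%:R e.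
(* A round costs 2c for two products and 1 for a subtraction; the constant 4c + 2 is twice that, and
   its half absorbs the earlier rounds. *)
have := leq_expn_nlg k.+1; have := leq_mul (leqnn (2 * c + 1)) (nlg_double k).
by move: IH; rewrite -/n; lia.
Qed.

Lemma logS_cost k p : (logS emb mul k p).2 <= (5 * c + 4) * nlg k.
Proof.
set n := 2 ^ k; pose g := (invS mul k p).1; pose p' := (derivS n p).1.
pose h := (mul n p' g).1.
have -> : (logS emb mul k p).2 =
  (invS mul k p).2 + ((derivS n p).2 + ((mul n p' g).2 + (integS emb n h).2)) by [].
have := fmul_nlg k p' g; have := derivS_cost n p; have := integS_cost n h.
by have := leq_expn_nlg k; have := invS_cost k p; rewrite -/n; lia.
Qed.

Lemma expS_cost k h : (expS emb mul k h).2 <= (12 * c + 12) * nlg k.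
Proof.
elim: k => [|k IH] //; set n := 2 ^ k.+1.
pose e := (expS emb mul k h).1; pose l := (logS emb mul k.+1 e).1.
pose r := (subS n h l).1; pose r' := (addS n 1 r).1.
have -> : (expS emb mul k.+1 h).2 =
  (expS emb mul k h).2 + ((logS emb mul k.+1 e).2 +
    ((subS n h l).2 + ((addS n 1%R r).2 + (mul n e r').2))) by [].
have := fmul_nlg k.+1 e r'; have := addS_cost n 1 r; have := subS_cost n h l.
(* A round costs 5c + 4 for the logarithm, c for the product and 2 for the linear operations; 12c +
   12 is twice that. *)
have := leq_expn_nlg k.+1; have := leq_mul (leqnn (6 * c + 6)) (nlg_double k).
by have := logS_cost k.+1 e; move: IH; rewrite -/n; lia.
Qed.

Lemma ln_g_cost k : (ln_g emb mul k).2 <= (5 * c + 8) * nlg k.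
Proof.
set n := 2 ^ k; pose e := (inv_facts emb n.+1).1.
pose p : {poly A} := (\poly_(i < n) e`_i.+1)%R.
have -> : (ln_g emb mul k).2 = (inv_facts emb n.+1).2 +
  ((logS emb mul k p).2 + (oppS n (logS emb mul k p).1).2) by [].
have := inv_facts_cost n.+1; have := logS_cost k p.
have := oppS_cost n (logS emb mul k p).1; have := leq_expn_nlg k.
have : 0 < n by rewrite expn_gt0.
by rewrite -/n; lia.
Qed.

Lemma ln_gy_cost k y : (ln_gy emb mul k y).2 <= (5 * c + 8) * nlg k.
Proof.
set n := 2 ^ k; pose e := (inv_facts emb n).1.
pose u := tabC n (fun i => if i is 0 then ret 1%R
                           else z <-- Defs.mulC y (e`_i)%R ;; Defs.oppC z).
have -> : (ln_gy emb mul k y).2 = (inv_facts emb n).2 +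
  (u.2 + ((logS emb mul k u.1).2 + (oppS n (logS emb mul k u.1).1).2)) by [].
have : u.2 <= 2 * n by apply: snd_tabC_leq => -[].
have := inv_facts_cost n; have := logS_cost k u.1.
by have := oppS_cost n (logS emb mul k u.1).1; have := leq_expn_nlg k; rewrite -/n; lia.
Qed.

(** There are at most k levels of halving. With L = lg(2^k), a level costs at most (6c + 1) [size B]
    L: 2c for the numerator products, 4c for the denominator, 1 for the addition. The leaves add
    [size B] negations. *)
Lemma frac_sum_cost depth B k : size B <= 2 ^ k ->
  (frac_sum mul depth B).2 <= (6 * c + 1) * (size B * (lg (2 ^ k) * k)) + size B.
Proof.
elim: depth B k => [|j IH] [|b [|b' B]] k //; try by rewrite /= leq_addl.
set BB := [:: b, b' & B]; set n := size BB => lenk.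
case: k lenk => [|k] lenk; first by rewrite /n in lenk.
have n2 : n./2 <= n by lia.
have szl : size (take n./2 BB) = n./2 by rewrite size_takel.
have szr : size (drop n./2 BB) = n - n./2 by rewrite size_drop.
pose l := frac_sum mul j (take n./2 BB); pose r := frac_sum mul j (drop n./2 BB).
pose x := mul n l.1.1 r.1.2; pose y := mul n r.1.1 l.1.2.
have -> : (frac_sum mul j.+1 BB).2 =
  l.2 + (r.2 + (x.2 + (y.2 + ((addS n x.1 y.1).2 + ((mul n.+1 l.1.2 r.1.2).2 + 0))))).
  by [].
have half : n - n./2 <= 2 ^ k /\ n./2 <= 2 ^ k by move: lenk; rewrite expnS; lia.
have n0 : 1 < n by [].
have := IH (take n./2 BB) k; rewrite szl => /(_ half.2); rewrite -/l => lc.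
have := IH (drop n./2 BB) k; rewrite szr => /(_ half.1); rewrite -/r => rc.
have xc : x.2 <= c * (n * lg n) by apply: fmul_cost.
have yc : y.2 <= c * (n * lg n) by apply: fmul_cost.
have dc : (mul n.+1 l.1.2 r.1.2).2 <= c * (n.+1 * lg n.+1) by apply: fmul_cost.
have ac := addS_cost n x.1 y.1.
set L := lg (2 ^ k.+1).
have L1 : lg (2 ^ k) <= L by apply: leq_lg; rewrite leq_exp2l.
have L2 : lg n <= L by apply: leq_lg.
(* The denominator is computed to length n + 1, which may pass the power of two 2^(k+1); the bounds
   n + 1 <= 2n and lg(n + 1) <= 2L give its factor 4. *)
have L3 : lg n.+1 <= 2 * L.
  apply: (@leq_trans (lg (2 ^ k.+2))); last by rewrite /L !lg_expn; lia.
  by apply: leq_lg; rewrite expnS; lia.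
have L0 : 0 < L by apply: lg_gt0.
have m1 : n * lg n <= n * L by rewrite leq_mul.
have m2 : n.+1 * lg n.+1 <= (2 * n) * (2 * L) by rewrite leq_mul //; lia.
have m3 : lg (2 ^ k) * k <= L * k by rewrite leq_mul.
have m4 := leq_mul (leqnn n./2) m3; have m5 := leq_mul (leqnn (n - n./2)) m3.
have c1 := leq_mul (leqnn c) m1; have c2 := leq_mul (leqnn c) m2.
have c4 := leq_mul (leqnn (6 * c + 1)) m4; have c5 := leq_mul (leqnn (6 * c + 1)) m5.
have nL : n <= n * L by rewrite leq_pmulr.
have e1 : n./2 * (L * k) + (n - n./2) * (L * k) = n * (L * k) by rewrite -mulnDl subnKC.
have e2 : (6 * c + 1) * (n./2 * (L * k)) + (6 * c + 1) * ((n - n./2) * (L * k)) =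
   (6 * c + 1) * (n * (L * k)) by rewrite -mulnDr e1.
have e3 : (6 * c + 1) * (n * (L * k.+1)) =
  (6 * c + 1) * (n * (L * k)) + 6 * (c * (n * L)) + n * L by lia.
have e4 : c * (2 * n * (2 * L)) = 4 * (c * (n * L)) by lia.
rewrite e3; lia.
Qed.

Lemma size_mem_reshape (T : eqType) n m (s b : seq T) :
  b \in reshape (nseq m n) s -> size b <= n.
Proof.
elim: m s => [|m IH] s //=; rewrite inE => /predU1P[->|/IH //].
by rewrite size_take; case: ltnP.
Qed.

Lemma power_sums_cost k B :
  (power_sums mul k B).2 <= (11 * c + 5) * (size B * lg (2 ^ k) ^ 2 + nlg k).
Proof.
set n := 2 ^ k; set L := lg n; set bs := reshape (nseq (size B %/ n).+1 n) B.
have n0 : 0 < n by rewrite expn_gt0.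
have L0 : 0 < L by apply: lg_gt0.
have kL : k <= L by rewrite /L lg_expn leq_maxr.
pose g (b : seq int) := (6 * c + 2) * L ^ 2 * size b + (5 * c + 3) * nlg k.
apply: (@leq_trans (\sum_(b <- bs) g b)).
  apply: snd_foldC_leq => b z /size_mem_reshape sb; rewrite -/n in sb.
  pose fr := frac_sum mul (size b) b; pose i := invS mul k fr.1.2.
  pose h := mul n fr.1.1 i.1; pose s := addS n z h.1.
  change (fr.2 + (i.2 + (h.2 + s.2)) <= g b).
  have := addS_cost n z h.1; rewrite -/s => sc.
  have := fmul_nlg k fr.1.1 i.1; rewrite -/n -/h => hc.
  have := invS_cost k fr.1.2; rewrite -/i => ic.
  have := frac_sum_cost (size b) sb; rewrite -/n -/L -/fr => fc.
  have := leq_expn_nlg k; rewrite -/n => nW.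
  have e : size b * (L * k) <= size b * L ^ 2 by rewrite leq_mul // -mulnn leq_mul.
  have e' := leq_mul (leqnn (6 * c + 1)) e.
  have e2 : size b <= size b * L ^ 2 by rewrite leq_pmulr // expn_gt0 L0.
  rewrite /g -(mulnA _ (L ^ 2)) [L ^ 2 * _]mulnC.
  move: e' e2 fc; set X := size b * (L * k); set Y := size b * L ^ 2.
  by move: (size b) => sz; lia.
rewrite big_split /= -big_distrr /=.
have -> : \sum_(b <- bs) size b = size B.
  have -> : \sum_(b <- bs) size b = sumn (shape bs) by rewrite sumnE big_map.
  rewrite -size_flatten reshapeKr // sumn_nseq mulnC ltnW //.
  exact: ltn_ceil.
rewrite big_const_seq count_predT iter_addn_0 size_reshape size_nseq.
(* The full blocks number at most [size B] / n, so their n log n terms are absorbed by [size B] L^2;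
   the one additional block leaves a single [nlg k]. *)
have e1 : size B %/ n * nlg k <= size B * L ^ 2.
  rewrite /nlg -/n -/L mulnA -mulnn leq_mul ?leq_trunc_div //.
  by rewrite leq_pmulr.
have := leq_mul (leqnn (5 * c + 3)) e1; lia.
Qed.

Lemma sum_scaled_cost k (L : {poly A}) B :
  (sum_scaled mul k L B).2 <= (11 * c + 6) * (size B * lg (2 ^ k) ^ 2 + nlg k).
Proof.
pose p := (power_sums mul k B).1.
have -> : (sum_scaled mul k L B).2 =
  (power_sums mul k B).2 + (hadamardS (2 ^ k) L p).2 by [].
have := power_sums_cost k B; have := hadamardS_cost (2 ^ k) L p.
have := leq_expn_nlg k; lia.
Qed.

Lemma log_exp_cost d B0 (Bs : seq (A * seq int)) : 0 < d ->
  (log_exp emb mul d 0 B0 Bs).2 <= (28 * c + 27) *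
    ((size B0 + \sum_(yB <- Bs) size yB.2) * lg d ^ 2 +
     2 * (size Bs).+1 * (d * lg d)).
Proof.
move=> d0; set k := up_log 2 d; set n := 2 ^ k.
have Ld : lg n = lg d by rewrite lg_expn.
pose L0 := ln_g emb mul k; pose H0 := sum_scaled mul k L0.1 B0.
pose F (yB : A * seq int) acc :=
  L <-- ln_gy emb mul k yB.1 ;; S <-- sum_scaled mul k L yB.2 ;; addS n acc S.
pose H1 := foldC F Bs H0.1; pose H := addS n H1.1 (emb 0 *: 'X)%R.
pose E := expS emb mul k H.1.
have -> : (log_exp emb mul d 0 B0 Bs).2 = L0.2 + (H0.2 + (H1.2 + (H.2 + (E.2 + 0)))).
  by [].
(* Rounding d up to a power of two at most doubles the length and leaves [lg] unchanged. *)
have Wd : nlg k <= 2 * (d * lg d).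
  rewrite /nlg -/n Ld mulnA leq_mul // /n /k; case: d d0 {k n Ld L0 H0 F H1 H E} => [|[|d]] // _.
  have := up_log_gtn (isT : 1 < 2) (isT : 1 < d.+2).
  have : 0 < up_log 2 d.+2 by rewrite up_log_gt0.
  by case: (up_log 2 d.+2) => // m _ /ltnW; rewrite expnS leq_mul2l.
have := ln_g_cost k; rewrite -/L0 => c1.
have := sum_scaled_cost k L0.1 B0; rewrite -/H0 -/n Ld => c2.
have := addS_cost n H1.1 (emb 0 *: 'X)%R; rewrite -/H => c3.
have := expS_cost k H.1; rewrite -/E => c4.
have := leq_expn_nlg k; rewrite -/n => nW.
(* The cost of one class: 5c + 8 for the logarithm, 11c + 6 for the scaled sum, 1 for the addition.
   The part outside the classes has constant 28c + 27, which dominates. *)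
pose g (yB : A * seq int) := (16 * c + 15) * (size yB.2 * lg d ^ 2 + nlg k).
have c5 : H1.2 <= \sum_(yB <- Bs) g yB.
  apply: snd_foldC_leq => yB acc _.
  pose Ly := ln_gy emb mul k yB.1; pose S := sum_scaled mul k Ly.1 yB.2.
  change (Ly.2 + (S.2 + (addS n acc S.1).2) <= g yB).
  have := ln_gy_cost k yB.1; have := sum_scaled_cost k Ly.1 yB.2.
  have := addS_cost n acc S.1; rewrite -/S -/Ly -/n Ld /g.
  by move: (size yB.2 * lg d ^ 2) => X; lia.
have e : \sum_(yB <- Bs) g yB = (16 * c + 15) *
    ((\sum_(yB <- Bs) size yB.2) * lg d ^ 2 + size Bs * nlg k).
  rewrite -big_distrr /= big_split /= -big_distrl /= big_const_seq count_predT.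
  by rewrite iter_addn_0 [nlg k * _]mulnC.
rewrite e in c5.
have e1 := leq_mul (leqnn (size Bs).+1) Wd.
set s := \sum_(yB <- Bs) size yB.2 in c5 *.
apply: (@leq_trans ((28 * c + 27) * ((size B0 + s) * lg d ^ 2 + (size Bs).+1 * nlg k))).
  lia.
by rewrite leq_mul // leq_add // [2 * _]mulnC -mulnA.
Qed.

End SeriesCost.

Lemma cyc_denum1_cost c (mul : fft_mul rat c) a : 0 < size a ->
  (cyc_denum1 mul a).2 <= (84 * c + 90) * (size a * lg (size a) ^ 2).
Proof.
set N := size a => N0.
pose L := log_exp idfun mul N 0 [seq Posz b | b <- a] [::].
pose p := prodC [seq (b%:R : rat)%R | b <- a].
pose e := inv_facts (idfun : {rmorphism rat -> rat}) N.
pose P := tabC N (fun m =>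
          x <-- Defs.mulC (e.1`_m)%R (p.1^-1)%R ;;
          y <-- signC (N + m + 1) x ;;
          Defs.mulC y (L.1`_(N - 1 - m))%R).
have -> : (cyc_denum1 mul a).2 = L.2 + (p.2 + (1 + (e.2 + (P.2 + 0)))) by [].
have : P.2 <= 3 * N.
  by apply: snd_tabC_leq => m; rewrite /= add1n addn1 !ltnS snd_signC_leq.
have : p.2 <= N by rewrite (leq_trans (snd_prodC_leq _)) // size_map.
have := inv_facts_cost (idfun : {rmorphism rat -> rat}) N; rewrite -/e.
have := @log_exp_cost _ idfun _ mul N [seq Posz b | b <- a] [::] N0.
rewrite -/L big_nil size_map -/N addn0 muln1.
have l1 : 0 < lg N := lg_gt0 N.
have : lg N <= lg N ^ 2 by rewrite -mulnn leq_pmull.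
move/(leq_mul (leqnn N)) => h2; have := leq_mul (leqnn (28 * c + 27)) h2.
have : N <= N * lg N ^ 2 by rewrite leq_pmulr // expn_gt0 l1.
move: (N * lg N ^ 2) (N * lg N) h2 => X Y h2; lia.
Qed.

(** * Cost of the case f > 1 *)

Section CycDenumCost.
Context (f c : nat) (mul : fft_mul (ringR f) c) (a : seq nat).

Lemma sum_residue_classes (rs : seq nat) : uniq rs ->
  \sum_(r <- rs) count (fun b => b %% f == r) a <= size a.
Proof.
move=> urs; under eq_bigr do rewrite -sum1_count.
rewrite (exchange_big_dep predT) //= -sum1_size; apply: leq_sum => b _.
rewrite sum1_count (eq_count (a2 := pred1 (b %% f))) => [|r]; last exact: eq_sym.
by rewrite count_uniq_mem // leq_b1.
Qed.

Lemma size_residues : 0 < f -> size (residues a f) <= f /\ size (residues a f) <= size a.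
Proof.
move=> f0; split.
  rewrite -[leqRHS](size_iota 0); apply: uniq_leq_size; first exact: undup_uniq.
  move=> r; rewrite mem_undup mem_iota => /mapP[b _ ->].
  by rewrite add0n ltn_pmod.
rewrite (leq_trans (size_undup _)) // size_map size_filter.
exact: count_size.
Qed.

Lemma cyc_denum_R_cost : 0 < f -> has (dvdn f) a ->
  (cyc_denum_R mul a).2 <= (112 * c + 120) *
    (f * count (dvdn f) a * lg (count (dvdn f) a) +
     size a * lg (count (dvdn f) a) ^ 2).
Proof.
move=> f0; rewrite has_count => d0; pose d := size (multiples f a).
have dE : count (dvdn f) a = d by rewrite /d size_filter.
rewrite dE in d0 *; have [rf ra] := size_residues f0.
set rs := residues a f in rf ra.
pose v := mapC (fun r => reduceR f (- (f%:R)^-1 *: ('X^r * ((theta f)^`() \Po 'X^r)))%R) rs.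
pose y := mapC (fun w : ringR f => Defs.subC w 1%R) v.1.
pose B0 := [seq Posz b | b <- multiples f a].
pose Bs := zip y.1 [seq [seq Posz b | b <- a & b %% f == r] | r <- rs].
pose M := log_exp (embR f) mul d 0 B0 Bs.
pose pv := prodC [seq (v.1`_(index (b %% f)%N rs))%R | b <- nonmultiples f a].
pose R := mapC (fun m => Defs.mulC (M.1`_(d - 1 - m))%R pv.1) (iota 0 d).
have -> : (cyc_denum_R mul a).2 = v.2 + (y.2 + (M.2 + (pv.2 + R.2))) by [].
have yE : y.1 = [seq (v_elt f r - 1)%R | r <- rs] by rewrite /y /v !fst_mapC -map_comp.
have BsE : Bs = [seq ((v_elt f r - 1)%R, [seq Posz b | b <- a & b %% f == r]) | r <- rs].
  by rewrite /Bs yE zip_map.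
have sv : size v.1 = size rs by rewrite /v fst_mapC size_map.
have v2 : v.2 <= size a.
  by apply: leq_trans ra; rewrite -[leqRHS]mul1n; apply: snd_mapC_leq.
have y2 : y.2 <= size a.
  by apply: leq_trans ra; rewrite -sv -[leqRHS]mul1n; apply: snd_mapC_leq.
have R2 : R.2 <= 1 * d by rewrite -[d in _ * d](size_iota 0); apply: snd_mapC_leq.
have da : d <= size a by rewrite /d size_filter count_size.
have pv2 : pv.2 <= size a.
  by rewrite (leq_trans (snd_prodC_leq _)) // size_map size_filter count_size.
have M2 := @log_exp_cost _ (embR f) _ mul d B0 Bs d0; rewrite -/M in M2.
have sB : size B0 + \sum_(yB <- Bs) size yB.2 <= 2 * size a.
  rewrite mul2n -addnn leq_add ?size_map // BsE big_map.
  apply: leq_trans (sum_residue_classes (undup_uniq _)).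
  by apply: leq_sum => r _; rewrite /= size_map size_filter.
(* At most f classes, and one further unit of cost for the part of the method outside the classes; f
   is at least 1. *)
have sBs : (size Bs).+1 <= 2 * f by rewrite BsE size_map mul2n -addnn -add1n leq_add.
have l1 : 0 < lg d := lg_gt0 d.
have e1 : size a <= size a * lg d ^ 2 by rewrite leq_pmulr // expn_gt0 l1.
have e2 := leq_mul sB (leqnn (lg d ^ 2)).
have e3 := leq_mul sBs (leqnn (d * lg d)).
have e4 : (size B0 + \sum_(yB <- Bs) size yB.2) * lg d ^ 2 + 2 * (size Bs).+1 * (d * lg d) <=
    4 * (f * d * lg d + size a * lg d ^ 2) by lia.
have := leq_trans M2 (leq_mul (leqnn (28 * c + 27)) e4).
move: (size a * lg d ^ 2) (f * d * lg d) e1 => X Y e1; lia.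
Qed.

Lemma cyc_denum_S_cost (M : seq (ringR f)) : has (dvdn f) a ->
  (cyc_denum_S a M).2 <= 11 * count (dvdn f) a.
Proof.
rewrite has_count; pose d := size (multiples f a).
have -> : count (dvdn f) a = d by rewrite /d size_filter.
move=> d0; pose p := prodC [seq (b%:R : rat)%R | b <- multiples f a].
pose e := inv_facts (idfun : {rmorphism rat -> rat}) d.
pose w := ((reduceS f (cyclo_hat f)).1 * (reduceS f (cyclo f)^`()).1)%R.
pose Q := mapC (fun m =>
   Mm <-- reduceS f (repR (M`_m)%R) ;;
   cm <-- Defs.mulC Mm w ;;
   x <-- Defs.mulC (e.1`_m)%R (p.1^-1)%R ;;
   s <-- signC (d + m + 1) x ;;
   Defs.mulC (embS f s) cm) (iota 0 d).
have -> : (cyc_denum_S a M).2 = 1 + (1 + (1 + (p.2 + (1 + (e.2 + (Q.2 + 0)))))) by [].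
have : Q.2 <= 5 * d.
  rewrite -[d in _ * d](size_iota 0); apply: snd_mapC_leq => m.
  by rewrite /= !add1n addn1 !ltnS snd_signC_leq.
have : p.2 <= d by rewrite (leq_trans (snd_prodC_leq _)) // size_map.
have := inv_facts_cost (idfun : {rmorphism rat -> rat}) d; rewrite -/e; lia.
Qed.

End CycDenumCost.

Theorem theorem2p10 :
  forall c : nat, exists K : nat,
  forall a : seq nat,
    all (fun b => 0 < b) a ->
    \big[gcdn/0]_(b <- a) b = 1 ->
    (forall mul : fft_mul rat c,
       let r := cyc_denum1 mul a in
       computes_wave 1 a r.1 /\
       r.2 <= K * (size a * lg (size a) ^ 2))
    /\
    (forall f : nat, 1 < f -> has (fun b => f %| b) a ->
     forall mul : fft_mul (ringR f) c,
       let d := count (fun b => f %| b) a in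
       let r := cyc_denum mul a in
       [/\ computes_wave f a (output r),
           opsS r <= K * d &
           opsR r <= K * (f * d * lg d + size a * lg d ^ 2)]).
Proof.
(* This constant, from the operations in R, also dominates 84c + 90 for f = 1 and 11 for the
   operations in S. *)
move=> c; exists (112 * c + 120) => a a_gt0 gcd1; split=> [mul|f f1 fa mul].
  (* The gcd of the empty sequence is 0, so gcd 1 forces a nonempty one. *)
  have N0 : 0 < size a by case: a gcd1 {a_gt0} => //; rewrite big_nil.
  split; first exact: cyc_denum1_correct.
  by apply: leq_trans (cyc_denum1_cost mul N0) _; rewrite leq_mul //; lia.
split; first exact: cyc_denum_correct.
  by apply: leq_trans (cyc_denum_S_cost _ fa) _; rewrite leq_mul //; lia.
exact: cyc_denum_R_cost (ltnW f1) fa.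
Qed.
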